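(* The map $\gamma:\mathcal{T}\to\mathcal{P}$ and its inverse map $\bar\gamma:\mathcal{P}\to\mathcal{T}$ are size-preserving bijections between Fishburn trees and $(\mathbf{2+2})$-free posets. In particular, for each $n\ge1$ we have $|\mathcal{T}_n|=|\mathcal{P}_n|$.
   Context: Write $[k]=\{1,\dots,k\}$. A binary tree is either empty or a triple $T=(L,r,R)$ with $r$ a node (the root) and $L,R$ binary trees (left and right subtree). $V(T)$ is the set of nodes and the size of $T$ is $|V(T)|$. A vertex labeling is a map $\mathfrak{l}:V(T)\to\{1,2,\dots\}$; $\max(T)$ is the largest label, with $\max(\emptyset)=0$. Labeled binary trees are considered up to label-preserving isomorphism of binary trees. $T$ is decreasing if it is empty, or $T=(L,r,R)$ with $L,R$ decreasing and $\mathfrak{l}(r)\ge\max\{\max(L),\max(R)\}$. $T$ is strictly decreasing to the left if it is empty, or $T=(L,r,R)$ with $\mathfrak{l}(r)>\max(L)$ and $L,R$ strictly decreasing to the left. An endotree of size $n$ is a decreasing binary tree of size $n$ that is strictly decreasing to the left and has all labels in $[n]$; it is regular if the set of its labels equals $[k]$ for some $k\le n$. The in-order traversal of $T=(L,r,R)$ traverses $L$ recursively, then visits $r$, then traverses $R$ recursively; $v_i$ is the $i$-th visited node. Put $\mathrm{asctops}(T)=\{v_1\}\cup\{v_i: v_i\text{ has a left child}\}$ and $\mathrm{nub}(T)=\{v_j:\mathfrak{l}(v_i)\ne\mathfrak{l}(v_j)\text{ for each }i<j\}$ (both empty for the empty tree). A Fishburn tree is a regular endotree $T$ with $\mathrm{nub}(T)=\mathrm{asctops}(T)$;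 $\mathcal{T}$ is the set of Fishburn trees and $\mathcal{T}_n$ the set of those of size $n$. A maximal right path is a nonempty sequence of nodes $(w_1,\dots,w_m)$ with $w_{i+1}$ the right child of $w_i$, where $w_1$ is not a right child of any node and $w_m$ has no right child; maximal left paths are defined analogously. $\mathrm{rpath}(v)$ and $\mathrm{lpath}(v)$ are the unique maximal right and left paths containing $v$. For nonempty $T$ with root $r$, $\mathrm{diag}(T)=\mathrm{lpath}(r)$ (viewed as a set; it is contained in $\mathrm{asctops}(T)$) and $\overline{\mathrm{diag}}(T)=\mathrm{asctops}(T)\setminus\mathrm{diag}(T)$. For a Fishburn tree $T$ with $k=\max(T)$, the set $\mathrm{asctops}(T)$ has exactly one node of each label $i\in[k]$. If $v\in\mathrm{asctops}(T)$ has label $i$, let $W_i=\mathrm{rpath}(v)$ if $v\in\mathrm{diag}(T)$, and $W_i=\mathrm{rpath}(\mathrm{lchild}(v))$ if $v\in\overline{\mathrm{diag}}(T)$, where $\mathrm{lchild}(v)$ is the left child of $v$; $W_1,\dots,W_k$ are exactly the maximal right paths of $T$, and for $u\in V(T)$, $\mathfrak{b}(u)$ denotes the index $i$ with $u\in W_i$. Let $B_i$ be the multiset $\{\mathfrak{l}(u):u\in W_i\}$ and $\mathfrak{P}(T)=B_1\dots B_k$. Posets are finite and considered up to isomorphism. A poset is $(\mathbf{2+2})$-free if it has no induced subposet isomorphic to the disjoint union of two 2-element chains. $\mathcal{P}_n$ is the set of (isomorphism classes of) $(\mathbf{2+2})$-free posets with $n$ elements and $\mathcal{P}=\bigcup_{n\ge0}\mathcal{P}_n$.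 The strict down-set of $u\in Q$ is $D(u)=\{v:v<u\}$; a poset is $(\mathbf{2+2})$-free if and only if its strict down-sets form a chain $\emptyset=D_1\subset D_2\subset\dots\subset D_k$ under inclusion (distinct sets), and one puts $D_{k+1}=Q$. The level of $u$ is $\mathrm{lev}(u)=i$ if $D(u)=D_i$. The map $\gamma$: $\gamma(T)$ is the poset with underlying set $V(T)$ and order $u<v\iff\mathfrak{b}(u)<\mathfrak{l}(v)$. The map $\bar\gamma$: given $Q\in\mathcal{P}$ with strict down-sets $D_1\subset\dots\subset D_k$, put $\mathfrak{l}(u)=\mathrm{lev}(u)$ and $\mathfrak{b}(u)=\min\{i:u\in D_i\}-1$ for $u\in Q$, and let $B_i$ be the multiset containing one copy of $\mathfrak{l}(u)$ for each $u\in Q$ with $\mathfrak{b}(u)=i$, $i\in[k]$; $\bar\gamma(Q)$ is the unique Fishburn tree $T$ with $\mathfrak{P}(T)=B_1\dots B_k$ (such a tree exists and is unique for every list of $k$ nonempty multisets whose elements form exactly the set $[k]$ and such that $j\in B_i$ implies $j\le i$). The empty tree corresponds to the empty poset. *)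

(* Defs.v *)
From HB Require Import structures.
From mathcomp Require Import all_boot all_order.
From mathcomp Require Import finmap multiset.
From mathcomp Require Import classical_sets cardinality.

Set Implicit Arguments.
Unset Strict Implicit.
Unset Printing Implicit Defensive.

Import Order.TTheory.

(* Label-preserving isomorphism of binary trees is equality in this type. *)
Inductive ltree := Leaf | Node of ltree & nat & ltree.

Fixpoint ltree_encode (T : ltree) : GenTree.tree nat :=
  if T is Node L a R
  then GenTree.Node 0 [:: ltree_encode L; GenTree.Leaf a; ltree_encode R]
  else GenTree.Node 1 [::].

Fixpoint ltree_decode (t : GenTree.tree nat) : ltree :=
  if t is GenTree.Node 0 [:: l; GenTree.Leaf a; r]
  then Node (ltree_decode l) a (ltree_decode r) else Leaf.

Lemma ltree_encodeK : cancel ltree_encode ltree_decode.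
Proof. by elim=> //= L -> a R ->. Qed.

HB.instance Definition _ := Countable.copy ltree (can_type ltree_encodeK).

(* A node is the sequence of directions (false = left, true = right) leading
   to it from the root [::]. *)
Definition node := seq bool.

Definition child (d : bool) (v : node) : node := rcons v d.
Notation lchild := (child false).
Notation rchild := (child true).

(* V(T), listed in in-order: v_(i+1) is nth [::] (nodes T) i. *)
Fixpoint nodes (T : ltree) : seq node :=
  if T is Node L _ R
  then map (cons false) (nodes L) ++ [::] :: map (cons true) (nodes R)
  else [::].

Fixpoint label (T : ltree) (v : node) : nat :=
  if T is Node L a R then
    if v is d :: v' then label (if d then R else L) v' else a
  else 0.

Definition tree_size (T : ltree) : nat := size (nodes T).
Definition labels (T : ltree) : seq nat := [seq label T v | v <- nodes T].
Definition maxlab (T : ltree) : nat := \max_(a <- labels T) a.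

Fixpoint decreasing (T : ltree) : bool :=
  if T is Node L a R
  then [&& decreasing L, decreasing R & maxn (maxlab L) (maxlab R) <= a]
  else true.

Fixpoint strictly_decreasing_left (T : ltree) : bool :=
  if T is Node L a R
  then [&& maxlab L < a, strictly_decreasing_left L & strictly_decreasing_left R]
  else true.

Definition endotree (T : ltree) : bool :=
  [&& decreasing T, strictly_decreasing_left T
    & all (fun a => 0 < a <= tree_size T) (labels T)].

Definition regular (T : ltree) : bool :=
  [exists k : 'I_(tree_size T).+1, perm_eq (undup (labels T)) (iota 1 k)].

Definition asctops (T : ltree) : seq node :=
  [seq v <- nodes T | (index v (nodes T) == 0) || (lchild v \in nodes T)].

Definition nub (T : ltree) : seq node :=
  [seq v <- nodes T | all (fun w => label T w != label T v)
                          (take (index v (nodes T)) (nodes T))].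

(* nub T and asctops T are both subsequences of nodes T, so that equality of
   sequences is equality of sets. *)
Definition is_fishburn (T : ltree) : bool :=
  [&& endotree T, regular T & nub T == asctops T].

Record fishburn :=
  Fishburn { ltree_of_fishburn :> ltree; _ : is_fishburn ltree_of_fishburn }.
HB.instance Definition _ := [isSub for ltree_of_fishburn].
HB.instance Definition _ := [Countable of fishburn by <:].

Definition empty_fishburn : fishburn :=
  @Fishburn Leaf ltac:(apply/and3P; split=> //; by apply/existsP; exists ord0).

Definition is_max_path (d : bool) (T : ltree) (p : seq node) : bool :=
  [&& p != [::], all (mem (nodes T)) p, sorted (frel (child d)) p,
      all (fun v => child d v != head [::] p) (nodes T)
    & child d (last [::] p) \notin nodes T].

(* The maximal path in direction d through v, looked up among all sequences
   w, child d w, child d (child d w), ...  of length at most tree_size T. *)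
Definition max_path (d : bool) (T : ltree) (v : node) : seq node :=
  head [::]
    [seq p <- [seq traject (child d) w m | w <- nodes T, m <- iota 1 (tree_size T)]
       | is_max_path d T p && (v \in p)].
Notation lpath := (max_path false).
Notation rpath := (max_path true).

Definition diag (T : ltree) : seq node := lpath T [::].

(* In a Fishburn tree exactly one node of asctops T has label i, for each i
   in [maxlab T]; other trees and indices are irrelevant. *)
Definition W (T : ltree) (i : nat) : seq node :=
  if [seq v <- asctops T | label T v == i] is v :: _ then
    if v \in diag T then rpath T v else rpath T (lchild v)
  else [::].

(* The index i with u \in W_i; maxlab T + 1 if there is none, which does not
   happen for a node of a Fishburn tree. *)
Definition blab (T : ltree) (u : node) : nat :=
  (find (fun i => u \in W T i) (iota 1 (maxlab T))).+1.

Definition treeB (T : ltree) : seq {mset nat}%mset :=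
  [seq seq_mset [seq label T u | u <- W T i] | i <- iota 1 (maxlab T)].

Section Relations.
Variables V W : finType.
Implicit Types (r : rel V) (s : rel W).

Definition rel_embeds r s : bool :=
  [exists f : {ffun V -> W},
     injectiveb f && [forall x, forall y, s (f x) (f y) == r x y]].

Definition rel_iso r s : bool :=
  [exists f : {ffun V -> W},
     [&& injectiveb f, [forall z, z \in codom f]
       & [forall x, forall y, s (f x) (f y) == r x y]]].

Definition strict_order r : bool :=
  [forall x, ~~ r x x] &&
  [forall x, forall y, forall z, r x y && r y z ==> r x z].

End Relations.

(* The disjoint union of the chains (b, false) < (b, true), for b : bool. *)
Definition two_plus_two : rel (bool * bool) :=
  fun x y => [&& x.1 == y.1, ~~ x.2 & y.2].

Definition two_two_free (V : finType) (r : rel V) : bool :=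
  ~~ rel_embeds two_plus_two r.

Definition poset_free d (Q : finPOrderType d) : bool :=
  two_two_free (@Order.lt d Q).

Definition poset_iso d d' (Q : finPOrderType d) (Q' : finPOrderType d') : bool :=
  rel_iso (@Order.lt d Q) (@Order.lt d' Q').

Definition rel_of n (r : {set 'I_n * 'I_n}) : rel 'I_n :=
  fun x y => (x, y) \in r.

(* P_n: the isomorphism classes of (2+2)-free posets on 'I_n. *)
Definition poset_classes (n : nat) : {set {set {set 'I_n * 'I_n}}} :=
  equivalence_partition (fun r s => rel_iso (rel_of r) (rel_of s))
    [set r : {set 'I_n * 'I_n} | strict_order (rel_of r)
                               & two_two_free (rel_of r)]%SET.

Definition fishburn_trees (n : nat) : set fishburn :=
  [set T : fishburn | tree_size T = n]%classic.

Definition gamma (T : fishburn) : Type := seq_sub (nodes T).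
HB.instance Definition _ (T : fishburn) :=
  Finite.copy (gamma T) (seq_sub (nodes T)).

Definition gamma_lt (T : fishburn) : rel (gamma T) :=
  fun u v => blab T (ssval u) < label T (ssval v).
Section Facts.
Implicit Types (T : ltree) (u v w : node).

Lemma max_pathP d T v :
  max_path d T v = [::] \/
  [/\ is_max_path d T (max_path d T v), v \in max_path d T v
    & exists w m, max_path d T v = traject (child d) w m].
Proof.
rewrite /max_path; set s := filter _ _.
have: head [::] s = [::] \/ head [::] s \in s.
  by case: s => [|p s] /=; [left | right; rewrite inE eqxx].
case=> [->|]; first by left.
rewrite mem_filter => /andP[/andP[h1 h2] /allpairsP[[w m] /= [_ _ e]]].
by right; split=> //; exists w, m.
Qed.

Lemma iter_child d n w : iter n (child d) w = w ++ nseq n d.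
Proof.
elim: n => [|n IH]; first by rewrite cats0.
by rewrite iterS IH /child -cats1 -catA -[[:: d]]/(nseq 1 d) -nseqD addn1.
Qed.

Lemma label_le_root T v : decreasing T -> v \in nodes T -> label T v <= label T [::].
Proof.
case: T => //= L a R /and3P[_ _]; rewrite geq_max => /andP[hL hR].
have mx T' v' : v' \in nodes T' -> label T' v' <= maxlab T'.
  by move=> h; rewrite /maxlab /labels big_map; apply: leq_bigmax_seq.
rewrite mem_cat inE => /or3P[/mapP[v' h ->]|/eqP->|/mapP[v' h ->]] //=.
  exact: leq_trans (mx _ _ h) hL.
exact: leq_trans (mx _ _ h) hR.
Qed.

Lemma label_decr T w s :
  decreasing T -> w ++ s \in nodes T -> label T (w ++ s) <= label T w.
Proof.
elim: w T => [|d w IH] T dT h; first exact: label_le_root.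
case: T dT h => //= L a R /and3P[dL dR _].
rewrite mem_cat inE /= => /orP[] /mapP[v' h []] -> e; subst v'; exact: IH.
Qed.

Lemma right_path_label T v u :
  decreasing T -> (forall w, v != rchild w) ->
  u \in rpath T v -> exists2 n, u = v ++ nseq n true & u \in nodes T.
Proof.
move=> dT nv; case: (max_pathP true T v) => [->//|[mp hv [w [m e]]]] hu.
have uT : u \in nodes T by case/and5P: mp => _ /allP/(_ _ hu).
move: hv hu; rewrite e => /trajectP[i _ ei] /trajectP[j _ ej].
case: i ei => [/= ei|i]; last by rewrite iterS => /eqP; rewrite (negPf (nv _)).
by exists j => //; rewrite ej -iter_child ei.
Qed.

Lemma label_le_W T i u :
  decreasing T -> u \in W T i -> label T u <= i.
Proof.
move=> dT; rewrite /W; case E: [seq _ <- _ | _] => [//|v s].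
have: v \in [seq v <- asctops T | label T v == i] by rewrite E mem_head.
rewrite mem_filter => /andP[/eqP <- _]; case: ifP => hd hu.
  have nv w : v != rchild w.
    move: hd; rewrite /diag; case: (max_pathP false T [::]) => [->//|].
    case=> _ h0 [x [m e]]; rewrite e => /trajectP[i1 _ ->].
    move: h0; rewrite e => /trajectP[i0 _]; rewrite !iter_child.
    case: x {e} => // _; rewrite cat0s; case: i1 => [|i1]; first by case: w.
    have -> : nseq i1.+1 false = rcons (nseq i1 false) false.
      by rewrite -cats1 -[[:: _]]/(nseq 1 false) -nseqD addn1.
    by apply/eqP => /rcons_inj[].
  have [n -> uT] := right_path_label dT nv hu.
  by apply: label_decr => //; rewrite -e.
have nv w : lchild v != rchild w by apply/eqP => /rcons_inj[].
have [n e uT] := right_path_label dT nv hu.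
by move: uT; rewrite e /child -cats1 -catA => uT; apply: label_decr.
Qed.

Lemma label_le_blab T u : decreasing T -> label T u <= maxlab T -> label T u <= blab T u.
Proof.
move=> dT lu; rewrite /blab; set p := fun i => _; set s := iota _ _.
case: (boolP (has p s)) => h; last first.
  by rewrite hasNfind // size_iota leqW.
have := nth_find 0 h; rewrite nth_iota; last by rewrite has_find size_iota in h.
by rewrite add1n => /(label_le_W dT).
Qed.

End Facts.

Lemma gamma_label_le (T : fishburn) (u : gamma T) :
  label T (ssval u) <= blab T (ssval u).
Proof.
have dT : decreasing T by case: T {u} => T /= /and3P[/and3P[]].
apply: label_le_blab => //; rewrite /maxlab big_map.
exact: leq_bigmax_seq (ssvalP u) _.
Qed.

Lemma gamma_lt_irr (T : fishburn) : irreflexive (@gamma_lt T).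
Proof. by move=> u; rewrite /gamma_lt ltnNge gamma_label_le. Qed.

Lemma gamma_lt_trans (T : fishburn) : transitive (@gamma_lt T).
Proof.
move=> v u w; rewrite /gamma_lt => uv vw.
exact: leq_ltn_trans (leq_trans (ltnW uv) (gamma_label_le v)) vw.
Qed.

Fact gamma_display : Order.disp_t. Proof. exact: Order.Disp tt tt. Qed.

HB.instance Definition _ (T : fishburn) :=
  Order.Lt_isPOrder.Build gamma_display (gamma T)
    (@gamma_lt_irr T) (@gamma_lt_trans T).

Section GammaBar.
Variables (d : Order.disp_t) (Q : finPOrderType d).

Definition downset (u : Q) : {set Q} := [set v | (v < u)%O]%SET.

(* D_1, ..., D_k: distinct, and increasing when Q is (2+2)-free. *)
Definition downsets : seq {set Q} :=
  sort (fun A B : {set Q} => A \subset B) (enum (downset @: setT)%SET).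

(* D_i for 1 <= i <= k+1; the default value gives D_(k+1) = Q. *)
Definition Dset (i : nat) : {set Q} := nth [set: Q]%SET downsets i.-1.

Definition lev (u : Q) : nat := (index (downset u) downsets).+1.

Definition bpos (u : Q) : nat :=
  let s := iota 1 (size downsets).+1 in
  (nth 0 s (find (fun i => u \in Dset i) s)).-1.

Definition posetB : seq {mset nat}%mset :=
  [seq seq_mset [seq lev u | u <- enum Q & bpos u == i]
     | i <- iota 1 (size downsets)].

(* The Fishburn tree T with treeB T = posetB (a default value if none). *)
Definition gammabar : fishburn :=
  xget empty_fishburn [set T : fishburn | treeB T = posetB]%classic.

End GammaBar.

(* Main.v *)
From HB Require Import structures.
Require Import Defs.
From mathcomp Require Import classical_sets cardinality.
From mathcomp Require Import all_boot all_order.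
From mathcomp Require Import finmap multiset.
From mathcomp Require Import zify.

(* The left subtree of a node v of a Fishburn tree carries labels below that of
   v, so v is the first node with its label exactly when this label has not
   been met before entering the subtree of v. Hence the first occurrence of the
   label a is known before its left subtree is built, and the tree can be
   rebuilt top-down in in-order from the right paths: attach to the first
   occurrence of a the path with index a, or, when a is a diagonal label (which
   is the case exactly when a occurs in B_a), the path of the next smaller
   diagonal label. This makes T |-> B_1 ... B_k injective, and onto the lists of
   nonempty blocks covering [k] with j <= i for j in B_i.
   On the other side, a poset is (2+2)-free exactly when u < v <-> b u < l v for
   two labelings l, b onto [k], and such labelings are unique: they are lev and
   bpos. For gamma T they are the label and the block index of a node. *)

Set Implicit Arguments.
Unset Strict Implicit.
Unset Printing Implicit Defensive.

Import Order.POrderTheory.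

(** * Nodes and paths *)

Fixpoint sub (T : ltree) (v : node) {struct v} : ltree :=
  if v is d :: v' then
    if T is Node L _ R then sub (if d then R else L) v' else Leaf
  else T.

Fixpoint spine (T : ltree) : seq nat :=
  if T is Node _ a R then a :: spine R else [::].

Fixpoint path_size (d : bool) (T : ltree) : nat :=
  if T is Node L _ R then (path_size d (if d then R else L)).+1 else 0.

(** The labels met strictly before [v] in the in-order traversal, by recursion on the path to [v],
    so that inductions need no positions in [nodes T]. *)
Fixpoint before (T : ltree) (v : node) : seq nat :=
  if T is Node L a R then
    match v with
    | [::] => labels L
    | false :: v' => before L v'
    | true :: v' => labels L ++ a :: before R v'
    end
  else [::].

Definition on_diag (v : node) : bool := all negb v.

Lemma labels_node L a R : labels (Node L a R) = labels L ++ a :: labels R.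
Proof. by rewrite /labels /= map_cat /= -!map_comp. Qed.

Lemma sub_leaf v : sub Leaf v = Leaf.
Proof. by case: v. Qed.

Lemma sub_cat T v w : sub T (v ++ w) = sub (sub T v) w.
Proof. by elim: v T => [|d v IH] [|L a R] //=; case: w {IH}. Qed.

Lemma mem_cons_map (b : bool) (v : node) (s : seq node) :
  ((b :: v) \in map (cons b) s) = (v \in s).
Proof. by rewrite mem_map // => x y []. Qed.

Lemma mem_cons_negb_map (b : bool) (v : node) (s : seq node) :
  ((b :: v) \in map (cons (~~ b)) s) = false.
Proof. by apply/mapP=> -[w _ [e _]]; case: b e. Qed.

Definition mem_map_cons :=
  (mem_cons_map, mem_cons_negb_map true, mem_cons_negb_map false).

Lemma nil_mem_cons (c : bool) (s : seq node) : ([::] \in map (cons c) s) = false.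
Proof. by apply/mapP=> -[w]. Qed.

Lemma mem_nodes T v : (v \in nodes T) = (sub T v != Leaf).
Proof.
elim: v T => [|d v IH] [|L a R] //=.
  by rewrite mem_cat inE eqxx orbT.
by case: d; rewrite mem_cat inE /= !mem_map_cons /= ?orbF IH.
Qed.

Lemma root_in_nodes L a R : [::] \in nodes (Node L a R).
Proof. by rewrite mem_nodes. Qed.

Lemma uniq_nodes T : uniq (nodes T).
Proof.
elim: T => //= L uL a R uR; rewrite cat_uniq /= !map_inj_uniq; try by move=> x y [].
rewrite uL uR !nil_mem_cons /= andbT.
by apply/hasPn => _ /mapP[v _ ->]; rewrite /= mem_map_cons.
Qed.

Lemma nodes_prefix T v w : v ++ w \in nodes T -> v \in nodes T.
Proof. by rewrite !mem_nodes sub_cat; case: (sub T v) => //; rewrite sub_leaf. Qed.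

Lemma nodes_cat T v w : (v ++ w \in nodes T) = (w \in nodes (sub T v)).
Proof. by rewrite !mem_nodes sub_cat. Qed.

Lemma label_sub T v w : label T (v ++ w) = label (sub T v) w.
Proof. by elim: v T => [|d v IH] [|L a R] //=. Qed.

Lemma sub_child T v d : sub T (child d v) = sub (sub T v) [:: d].
Proof. by rewrite /child -cats1 sub_cat. Qed.

Lemma nseq_in_nodes T d j : (nseq j d \in nodes T) = (j < path_size d T).
Proof.
rewrite mem_nodes; elim: j T => [|j IH] [|L a R] //=.
Qed.

Lemma spine_label T : [seq label T (nseq j true) | j <- iota 0 (path_size true T)] = spine T.
Proof.
elim: T => //= L _ a R IH; congr cons; rewrite -IH -(addn0 1) iotaDl -map_comp.
by apply: eq_map.
Qed.

Lemma spine_nil T : (spine T == [::]) = (T == Leaf).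
Proof. by case: T. Qed.

Lemma trajectE d v m : traject (child d) v m = [seq v ++ nseq j d | j <- iota 0 m].
Proof.
apply: (@eq_from_nth _ [::]) => [|i]; first by rewrite size_traject size_map size_iota.
rewrite size_traject => im; rewrite (set_nth_default v) ?size_traject //.
rewrite nth_traject // iter_child.
by rewrite (nth_map 0) ?size_iota // nth_iota.
Qed.

(** The [j]-th step down from [v] is a node exactly when [j < path_size d (sub T v)]. Hence
    containment in [T] bounds [m] from above and maximality bounds it from below. *)
Lemma is_max_path_traject T d v m :
  (forall w, v != child d w) ->
  is_max_path d T (traject (child d) v m) = (v \in nodes T) && (m == path_size d (sub T v)).
Proof.
move=> hv; case: m => [|m] /=.
  by rewrite mem_nodes; case: (sub T v).
rewrite /is_max_path -[v :: _]/(traject (child d) v m.+1).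
have -> : traject (child d) v m.+1 != [::] by [].
have -> : sorted (frel (child d)) (traject (child d) v m.+1) by exact: fpath_traject.
have -> /= : all (fun w => child d w != v) (nodes T).
  by apply/allP => w _; rewrite eq_sym hv.
rewrite last_traject iter_child.
have -> : child d (v ++ nseq m d) = v ++ nseq m.+1 d.
  by rewrite -iter_child -iterS iter_child.
rewrite nodes_cat nseq_in_nodes -leqNgt.
case: (boolP (v \in nodes T)) => //= vT.
rewrite eqn_leq [RHS]andbC andbC; congr andb.
have -> : all (mem (nodes T)) (traject (child d) (child d v) m)
          = all (mem (nodes T)) (traject (child d) v m.+1) by rewrite /= vT.
rewrite trajectE all_map.
apply/allP/idP => [/(_ m)|h j].
  by rewrite mem_iota add0n ltnSn /= nodes_cat nseq_in_nodes; apply.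
rewrite mem_iota add0n /= => jm; rewrite nodes_cat nseq_in_nodes.
exact: leq_trans jm h.
Qed.

(** Keeps the maximal path within the length bound of the search in [max_path]. *)
Lemma path_size_leq T d v : path_size d (sub T v) <= tree_size T.
Proof.
rewrite /tree_size.
have : {subset [seq v ++ nseq j d | j <- iota 0 (path_size d (sub T v))] <= nodes T}.
  move=> _ /mapP[j + ->]; rewrite mem_iota nodes_cat nseq_in_nodes //.
move/uniq_leq_size; rewrite size_map size_iota; apply.
rewrite map_inj_uniq ?iota_uniq // => i j /(congr1 size).
rewrite !size_cat !size_nseq; lia.
Qed.

(** The search succeeds because this path is among the candidates. Any hit is a [traject] from some
    [w] through [v], and [w] is [v] because [v] is no [d]-child. *)
Lemma max_path_traject T d v : v \in nodes T -> (forall w, v != child d w) ->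
  max_path d T v = traject (child d) v (path_size d (sub T v)).
Proof.
move=> vT hv; set p0 := traject _ _ _.
have mp0 : is_max_path d T p0 by rewrite is_max_path_traject // vT eqxx.
have ps : 0 < path_size d (sub T v) by move: vT; rewrite mem_nodes; case: (sub T v).
have vp0 : v \in p0 by rewrite /p0; case: (path_size _ _) ps => //= n _; rewrite mem_head.
case: (max_pathP d T v) => [|[mp vp [w [m e]]]].
  rewrite /max_path; set s := filter _ _.
  have : p0 \in s.
    rewrite mem_filter mp0 vp0; apply/allpairsP; exists (v, path_size d (sub T v)).
    by rewrite vT mem_iota ps add1n ltnS path_size_leq.
  case E : s => [|x s1] //= _ x0.
  have : x \in s by rewrite E mem_head.
  by rewrite mem_filter x0.
rewrite e in mp vp *; case/trajectP: vp => i _.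
case: i => [/= ev|i]; last by rewrite iterS => /eqP; rewrite (negPf (hv _)).
by move: mp; rewrite -ev is_max_path_traject // => /andP[_ /eqP ->].
Qed.

Lemma lchild_neq_rchild w v : lchild v != rchild w.
Proof. by apply/eqP => /rcons_inj[]. Qed.

Lemma on_diagP v : reflect (v = nseq (size v) false) (on_diag v).
Proof.
rewrite /on_diag; elim: v => [|[] v IH] /=; [by left | by right |].
by apply: (iffP IH) => [{1}->|[]].
Qed.

Lemma on_diag_child v d : on_diag (child d v) = ~~ d && on_diag v.
Proof. by rewrite /on_diag all_rcons. Qed.

Lemma on_diag_cat v w : on_diag v -> on_diag w -> size v <= size w ->
  w = v ++ nseq (size w - size v) false.
Proof.
move=> /on_diagP dv /on_diagP dw vw.
by rewrite {1}dw {1}dv -nseqD subnKC.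
Qed.

Lemma mem_diag T v : v \in nodes T -> (v \in diag T) = on_diag v.
Proof.
move=> vT; have rT : [::] \in nodes T by apply: (@nodes_prefix _ [::] v).
rewrite /diag max_path_traject //; last by case.
rewrite trajectE; apply/mapP/on_diagP => [[j _ ->]|ev]; first by rewrite size_nseq.
exists (size v) => //; rewrite mem_iota add0n /=.
by rewrite -nseq_in_nodes -ev; case: T vT {rT}.
Qed.

Lemma index0_nodes T v : v \in nodes T ->
  (index v (nodes T) == 0) = on_diag v && (lchild v \notin nodes T).
Proof.
elim: T v => //= L IHL a R _ [|d v].
  move=> _ /=; rewrite mem_cat inE /= !mem_map_cons /= orbF.
  rewrite mem_nodes index_cat nil_mem_cons size_map /= addn0.
  by case: L {IHL} => //= L b R'; rewrite size_cat /= addnS.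
rewrite mem_cat inE /=; case: d => /=; rewrite !mem_map_cons /= ?orbF.
  by move=> _; rewrite index_cat mem_map_cons /= addnS.
move=> vL; rewrite index_cat mem_map_cons vL index_map; last by move=> x y [].
by rewrite IHL // mem_cat inE /= !mem_map_cons /= orbF.
Qed.

Lemma take_index_nodes T v : v \in nodes T ->
  [seq label T w | w <- take (index v (nodes T)) (nodes T)] = before T v.
Proof.
elim: T v => //= L IHL a R IHR [|d v].
  move=> _; rewrite index_cat nil_mem_cons /= addn0 take_size_cat //.
  by rewrite -map_comp.
rewrite mem_cat inE; case: d => /=; rewrite !mem_map_cons /= ?orbF => vT.
  rewrite index_cat mem_map_cons /= index_map; last by move=> x y [].
  rewrite take_cat ltnNge leq_addr /= addKn /= map_cat /= -map_comp -IHR //.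
  by rewrite -map_take -map_comp.
rewrite index_cat mem_map_cons vT index_map; last by move=> x y [].
by rewrite take_cat size_map index_mem vT -map_take -map_comp -IHL.
Qed.

(** A diagonal node without a left child is the first node of the traversal, so the test for that
    node may be relaxed to [on_diag v]. *)
Lemma mem_asctops T v : (v \in asctops T) =
  (v \in nodes T) && (on_diag v || (lchild v \in nodes T)).
Proof.
rewrite mem_filter andbC; case: (boolP (v \in nodes T)) => //= vT.
by rewrite index0_nodes //; case: (lchild v \in _); rewrite ?orbT ?andbT ?andbF.
Qed.

Lemma mem_nub T v : (v \in nub T) = (v \in nodes T) && (label T v \notin before T v).
Proof.
rewrite mem_filter andbC; case: (boolP (v \in nodes T)) => //= vT.
rewrite -take_index_nodes //; apply/allP/negP => [h /mapP[w wt e]|h w wt].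
  by move: (h _ wt); rewrite e eqxx.
by apply/eqP => e; apply: h; apply/mapP; exists w.
Qed.

Lemma nub_inj T : {in nub T &, injective (label T)}.
Proof.
move=> v w; wlog le : v w / index v (nodes T) <= index w (nodes T).
  move=> th vn wn e; case: (leqP (index v (nodes T)) (index w (nodes T))) => h.
    exact: th.
  by apply/esym; apply: th => //; apply: ltnW.
rewrite !mem_filter => /andP[_ vT] /andP[/allP h wT] e.
apply/eqP; apply: contraT => vw.
have: v \in take (index w (nodes T)) (nodes T).
  rewrite in_take_leq; last by rewrite ltnW // index_mem.
  rewrite ltn_neqAle le andbT; apply: contra vw => /eqP /(congr1 (nth [::] (nodes T))).
  by rewrite !nth_index // => ->.
by move/h; rewrite e eqxx.
Qed.

Lemma nub_label T a : a \in labels T -> exists2 v, v \in nub T & label T v = a.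
Proof.
move=> /mapP[v0 v0T ea]; pose s := nodes T.
have hs : has (fun v => label T v == a) s by apply/hasP; exists v0; rewrite // ea.
pose i := find (fun v => label T v == a) s.
have is_ : i < size s by rewrite -has_find.
exists (nth [::] s i); last by apply/eqP; apply: (@nth_find _ [::] (fun v => label T v == a)).
rewrite mem_filter mem_nth // andbT index_uniq ?uniq_nodes //.
apply/(all_nthP [::]) => j; rewrite size_take is_ => ji; rewrite nth_take //.
have /eqP -> := @nth_find _ [::] (fun v => label T v == a) s hs.
by rewrite (before_find [::] ji).
Qed.

(** * Reconstructing a tree from its right paths *)

Lemma maxlab_leq T a : (maxlab T <= a) = all (fun b => b <= a) (labels T).
Proof.
apply/idP/allP => [h b bT|h].
  by apply: leq_trans h; apply: leq_bigmax_seq.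
by apply/bigmax_leqP_seq => b bT _; apply: h.
Qed.

Lemma label_le_maxlab T a : a \in labels T -> a <= maxlab T.
Proof. by move: (leqnn (maxlab T)); rewrite maxlab_leq => /allP h /h. Qed.

(* C a is the right path attached as left subtree at the first occurrence of
   the label a, and S collects the labels met before T in the traversal. *)
Fixpoint attached (C : nat -> seq nat) (S : seq nat) (T : ltree) : bool :=
  if T is Node L a R then
    [&& spine L == (if a \in S then [::] else C a), attached C S L
      & attached C (S ++ labels L ++ [:: a]) R]
  else true.

(** The spine fixes the root label and the spine of the right subtree; the root condition then fixes
    the spine of the left subtree, and [S] grows equally in both trees. *)
Lemma attached_inj C S T T' :
  attached C S T -> attached C S T' -> spine T = spine T' -> T = T'.
Proof.
elim: T T' S => [|L IHL a R IHR] [|L' a' R'] //= S.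
case/and3P=> /eqP sL fL fR /and3P[/eqP sL' fL' fR'] [ea sR].
move: sL' fL' fR'; rewrite -ea => sL' fL' fR'.
have eL : L = L' by apply: (IHL _ S) => //; rewrite sL sL'.
by subst L'; rewrite (IHR _ _ fR fR' sR).
Qed.

Section Attached.
Variable C : nat -> seq nat.
Hypothesis C_lt : forall a b, b \in C a -> 0 < b < a.

(** Outer induction on a strict bound for the labels, inner one on the length of [p]. A left subtree
    starts from [C a], whose entries are below [a] and so obey the previous bound. *)
Lemma attached_exists S p : exists2 T, attached C S T & spine T = p.
Proof.
have [m pm] : exists m, all (fun b => b < m) p.
  by exists (\max_(b <- p) b).+1; apply/allP => b bp; rewrite ltnS leq_bigmax_seq.
elim: m S p pm => [|m IHm] S p; first by case: p => // _; exists Leaf.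
elim: p S => [|a p IHp] S; first by exists Leaf.
case/andP=> am pm.
have [L fL sL] : exists2 L, attached C S L & spine L = if a \in S then [::] else C a.
  apply: IHm; case: ifP => // _; apply/allP => b /C_lt /andP[_ ba].
  exact: leq_trans ba am.
have [R fR sR] := IHp (S ++ labels L ++ [:: a]) pm.
by exists (Node L a R); rewrite /= ?sL ?eqxx ?fL ?sR.
Qed.

(** Every label is on the spine or enters through some [C a] with [a] already a label, so a property
    closed under [C] spreads from the spine to the whole tree. *)
Lemma attached_all (P : pred nat) S T : attached C S T ->
  (forall a, P a -> all P (C a)) -> all P (spine T) -> all P (labels T).
Proof.
move=> fT hC; elim: T S fT => //= L IHL a R IHR S /and3P[/eqP sL fL fR] /andP[Pa PR].
rewrite labels_node all_cat /= Pa (IHR _ fR) // (IHL _ fL) // sL.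
by case: ifP => // _; apply: hC.
Qed.

Lemma attached_sdl S T : attached C S T -> all (leq 1) (spine T) ->
  strictly_decreasing_left T.
Proof.
elim: T S => //= L IHL a R IHR S /and3P[/eqP sL fL fR] /andP[a0 R0].
have lt0 b c : c \in C b -> 0 < c by move=> /C_lt/andP[].
have L0 : all (leq 1) (spine L).
  by rewrite sL; case: ifP => // _; apply/allP => b; apply: lt0.
(* [maxlab L < a] becomes [maxlab L <= a.-1], a bound that passes from [b] to [C b], as
   [attached_all] requires. *)
rewrite (IHL _ fL) // (IHR _ fR) // !andbT -(ltn_predK a0) ltnS maxlab_leq.
apply: (attached_all fL) => [b ba|].
  apply/allP => c /C_lt; lia.
by rewrite sL; case: ifP => // _; apply/allP => b /C_lt; lia.
Qed.

Lemma attached_decreasing S T : attached C S T ->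
  (forall a, sorted geq (C a)) -> sorted geq (spine T) -> decreasing T.
Proof.
move=> fT hC; elim: T S fT => //= L IHL a R IHR S /and3P[/eqP sL fL fR] sR.
rewrite (IHR _ fR) ?(path_sorted sR) // (IHL _ fL) ?sL; last by case: ifP.
rewrite geq_max !maxlab_leq /=; apply/andP; split.
  apply: (attached_all fL) => [b ba|].
    by apply/allP => c /C_lt; lia.
  by rewrite sL; case: ifP => // _; apply/allP => b /C_lt; lia.
apply: (attached_all fR) => [b ba|].
  by apply/allP => c /C_lt; lia.
apply: order_path_min sR => x y z; rewrite /= /geq /=; lia.
Qed.

End Attached.

(** [attached] tests a label before its left subtree is traversed, while [before] counts that
    subtree too. Strict decrease to the left makes both tests agree, since the label of [v] is
    absent from its left subtree. *)
Lemma attachedP C S T : strictly_decreasing_left T ->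
  reflect {in nodes T, forall v, spine (sub T (lchild v)) =
             if label T v \in S ++ before T v then [::] else C (label T v)}
          (attached C S T).
Proof.
elim: T S => [|L IHL a R IHR] S; first by left.
move=> /and3P[La sL sR].
have aL : a \notin labels L.
  by apply/negP => /label_le_maxlab; rewrite leqNgt La.
apply: (iffP and3P) => [[/eqP eL /(IHL _ sL) fL /(IHR _ sR) fR] [|[] v]|h].
- by move=> _ /=; rewrite mem_cat (negPf aL) orbF.
- rewrite /= mem_cat inE !mem_map_cons /= => /fR.
  by rewrite -!catA.
- by rewrite /= mem_cat inE !mem_map_cons /= orbF => /fL.
split.
- by have /= := h [::] (root_in_nodes _ _ _); rewrite mem_cat (negPf aL) orbF => ->.
- apply/(IHL _ sL) => v vL; have /= := h (false :: v); apply.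
  by rewrite mem_cat !mem_map_cons vL.
- apply/(IHR _ sR) => v vR; have /= := h (true :: v); rewrite -!catA; apply.
  by rewrite mem_cat inE !mem_map_cons vR.
Qed.

Lemma subtree_mem T v : {subset labels (sub T v) <= labels T}.
Proof.
move=> _ /mapP[w wv ->]; rewrite -label_sub; apply: map_f.
by rewrite nodes_cat.
Qed.

Lemma spine_mem T : {subset spine T <= labels T}.
Proof.
elim: T => //= L _ a R IH b; rewrite labels_node mem_cat !inE.
by case/orP => [->|/IH ->]; rewrite ?orbT.
Qed.

Lemma decreasing_sub T v : decreasing T -> decreasing (sub T v).
Proof. by elim: v T => [|[] v IH] [|L a R] //= /and3P[dL dR _]; apply: IH. Qed.

Lemma sdl_sub T v :
  strictly_decreasing_left T -> strictly_decreasing_left (sub T v).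
Proof. by elim: v T => [|[] v IH] [|L a R] //= /and3P[_ dL dR]; apply: IH. Qed.

Lemma decreasing_spine T : decreasing T -> sorted geq (spine T).
Proof.
elim: T => //= L _ a R IH /and3P[_ dR]; rewrite geq_max => /andP[_].
rewrite maxlab_leq => /allP aR; have := IH dR.
move: (@spine_mem R); case: (spine R) => //= b s sR ->.
by rewrite andbT; apply/aR/sR/mem_head.
Qed.

Lemma sub_node T v : v \in nodes T ->
  sub T v = Node (sub T (lchild v)) (label T v) (sub T (rchild v)).
Proof.
rewrite mem_nodes !sub_child -[in label T v](cats0 v) label_sub.
by case: (sub T v).
Qed.

Lemma lchild_lt T v a : strictly_decreasing_left T -> v \in nodes T ->
  a \in labels (sub T (lchild v)) -> a < label T v.
Proof.
move=> /(@sdl_sub T v) + vT; rewrite (sub_node vT) /= => /andP[h _] /label_le_maxlab h'.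
exact: leq_ltn_trans h' h.
Qed.

Lemma before_diag T v : on_diag v -> v \in nodes T ->
  before T v = labels (sub T (lchild v)).
Proof.
rewrite /on_diag; elim: v T => [|[] v IH] [|L a R] //= dv.
by rewrite mem_cat inE !mem_map_cons /= orbF => vL; apply: IH.
Qed.

Lemma diag_nub T v : strictly_decreasing_left T -> on_diag v -> v \in nodes T ->
  v \in nub T.
Proof.
move=> sT dv vT; rewrite mem_nub vT before_diag //.
by apply/negP => /(lchild_lt sT vT); rewrite ltnn.
Qed.

(** In a Fishburn tree, the start of the right path [W T (label T v)] for [v] in [nub T]. *)
Definition path_head (v : node) : node := if on_diag v then v else lchild v.

Lemma path_head_neq v w : path_head v != rchild w.
Proof.
rewrite /path_head; case: ifP => // dv; last exact: lchild_neq_rchild.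
by apply/eqP => e; rewrite e on_diag_child in dv.
Qed.

(** [is_fishburn] freed of [tree_size], with [nub] and [asctops] compared node by node. *)
Record fishburn_spec (T : ltree) : Prop := FishburnSpec {
  fb_decr : decreasing T;
  fb_sdl : strictly_decreasing_left T;
  fb_labels : forall a, (a \in labels T) = (0 < a <= maxlab T);
  fb_nub : {in nodes T, forall v,
    (label T v \notin before T v) = on_diag v || (lchild v \in nodes T)} }.

Lemma fishburnP T : reflect (fishburn_spec T) (is_fishburn T).
Proof.
apply: (iffP and3P) => [[/and3P[dT sT _] /existsP[k rT] /eqP nT]|[dT sT lT nT]].
  have hk a : (a \in labels T) = (0 < a <= k).
    by rewrite -mem_undup (perm_mem rT) mem_iota add1n ltnS.
  split=> // [a|v vT]; last first.
    by have := mem_nub T v; rewrite nT mem_asctops vT.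
  rewrite hk; apply/idP/idP => /andP[a0 h]; rewrite a0 /=.
    by apply: label_le_maxlab; rewrite hk; lia.
  by apply: leq_trans h _; rewrite maxlab_leq; apply/allP => b; rewrite hk => /andP[].
(* All of [1, ..., maxlab T] occur as labels, so there are at least [maxlab T] nodes; [endotree] and
   [regular] need this bound. *)
have hT : maxlab T <= tree_size T.
  rewrite /tree_size -(size_map (label T)) -(size_iota 1 (maxlab T)).
  apply: uniq_leq_size (iota_uniq _ _) _ => a; rewrite mem_iota add1n ltnS => h.
  by rewrite -/(labels T) lT.
split.
- by rewrite /endotree dT sT; apply/allP => a; rewrite lT; lia.
- rewrite /regular; have hk : maxlab T < (tree_size T).+1 by [].
  apply/existsP; exists (Ordinal hk); apply: uniq_perm; rewrite ?undup_uniq ?iota_uniq //.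
  by move=> a; rewrite mem_undup lT mem_iota add1n ltnS.
- apply/eqP/eq_in_filter => v vT.
  have := mem_nub T v; have := mem_asctops T v.
  by rewrite !mem_filter vT /= !andbT => -> ->; apply: nT.
Qed.

(** * The right paths of a Fishburn tree *)

Section FishburnTree.
Variable T : ltree.
Hypothesis fT : fishburn_spec T.

Let dT := fb_decr fT.
Let sT := fb_sdl fT.

Lemma fb_asctops v : (v \in asctops T) = (v \in nub T).
Proof.
rewrite mem_asctops mem_nub; case: (boolP (v \in nodes T)) => //= vT.
by rewrite fb_nub.
Qed.

Lemma path_head_in v : v \in nub T -> path_head v \in nodes T.
Proof.
by rewrite -fb_asctops mem_asctops /path_head => /andP[vT]; case: ifP.
Qed.

(** [W] selects the head of a filtered list; labels are injective on [nub T], so this head is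
    [v]. *)
Lemma W_nub v : v \in nub T -> W T (label T v) =
  traject rchild (path_head v) (path_size true (sub T (path_head v))).
Proof.
move=> vn; rewrite /W; case E : [seq _ <- _ | _] => [|w s].
  have : v \in [seq w <- asctops T | label T w == label T v].
    by rewrite mem_filter eqxx fb_asctops.
  by rewrite E.
have : w \in [seq w <- asctops T | label T w == label T v] by rewrite E mem_head.
rewrite mem_filter fb_asctops => /andP[/eqP ew wn].
have {}ew := nub_inj wn vn ew; subst w.
have vT : v \in nodes T by move: vn; rewrite mem_nub => /andP[].
rewrite mem_diag //.
have -> : (if on_diag v then rpath T v else rpath T (lchild v)) = rpath T (path_head v).
  by rewrite /path_head; case: ifP.
by rewrite max_path_traject ?path_head_in //; apply: path_head_neq.
Qed.

Lemma W_labels v : v \in nub T ->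
  [seq label T u | u <- W T (label T v)] = spine (sub T (path_head v)).
Proof.
move=> vn; rewrite W_nub // trajectE -map_comp -spine_label.
by apply: eq_map => j /=; rewrite label_sub.
Qed.

End FishburnTree.

(** * Right paths determine a Fishburn tree *)

(** Labels weakly decrease along a right path, so sorting a block downwards recovers the path from
    its multiset. Blocks are indexed from 1, and index 0 stands for no path. *)
Definition sorted_block (Bs : seq {mset nat}%mset) (i : nat) : seq nat :=
  if i is j.+1 then sort geq (nth mset0 Bs j) else [::].

(** The next diagonal label below [a], or 0 if there is none; [i \in B i] marks the diagonal
    labels. *)
Definition pred_diag (B : nat -> seq nat) (a : nat) : nat :=
  \max_(i < a | val i \in B i) i.

(** For a diagonal [a], the path [B a] passes through the node itself, and its left child starts the
    path of the next diagonal label; otherwise [B a] starts at the left child. *)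
Definition attach (B : nat -> seq nat) (a : nat) : seq nat :=
  if a \in B a then B (pred_diag B a) else B a.

Lemma pred_diag_geq B a i : i < a -> i \in B i -> i <= pred_diag B a.
Proof. by move=> ia; apply: (@leq_bigmax_cond _ _ (@nat_of_ord a) (Ordinal ia)). Qed.

Lemma pred_diag_leq B a b :
  (forall i, i < a -> i \in B i -> i <= b) -> pred_diag B a <= b.
Proof. by move=> h; apply/bigmax_leqP => i; apply: h (ltn_ord i). Qed.

Lemma pred_diag_lt B a : 0 < a -> pred_diag B a < a.
Proof. by case: a => // a _; rewrite ltnS; apply: pred_diag_leq. Qed.

Lemma pred_diag_mem B a : 0 < pred_diag B a -> pred_diag B a \in B (pred_diag B a).
Proof.
rewrite /pred_diag; apply: (@big_ind _ (fun m => 0 < m -> m \in B m)) => //.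
by move=> x y hx hy; rewrite /maxn; case: ifP.
Qed.

Lemma sort_geq_mset (s : seq nat) : sorted geq s -> sort geq (seq_mset s) = s.
Proof.
move=> ss; have tr : transitive geq by move=> x y z /=; lia.
apply: (@sorted_eq _ geq) => //.
- by move=> x y /=; lia.
- by apply: sort_sorted => x y /=; lia.
- by rewrite perm_sort perm_eq_seq_mset.
Qed.

Section Reconstruction.
Variable T : ltree.
Hypothesis fT : fishburn_spec T.

Let dT := fb_decr fT.
Let sT := fb_sdl fT.
Let B := sorted_block (treeB T).

Lemma block_nub v : v \in nub T -> B (label T v) = spine (sub T (path_head v)).
Proof.
move=> vn; have : label T v \in labels T.
  by apply: map_f; move: vn; rewrite mem_nub => /andP[].
rewrite (fb_labels fT) => lv; rewrite /B /sorted_block.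
case E : (label T v) lv => [//|j] /= jT; rewrite (nth_map 0) ?size_iota //.
rewrite nth_iota // add1n -E W_labels // sort_geq_mset //.
by apply: decreasing_spine; apply: decreasing_sub.
Qed.

(** On the diagonal the path starts at [v] itself; off it, the path lies in the left subtree, where
    all labels are smaller. *)
Lemma block_diag v : v \in nub T -> (label T v \in B (label T v)) = on_diag v.
Proof.
move=> vn; have vT : v \in nodes T by move: vn; rewrite mem_nub => /andP[].
rewrite block_nub // /path_head; case: ifP => dv.
  by rewrite (sub_node vT) mem_head.
by apply/negP => /spine_mem /(lchild_lt sT vT); rewrite ltnn.
Qed.

Lemma block_root : spine T = B (maxlab T).
Proof.
case ET : T => [|L a R]; first by rewrite /maxlab big_nil.
have rT : [::] \in nodes T by rewrite ET root_in_nodes.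
have -> : maxlab (Node L a R) = label T [::].
  apply/eqP; rewrite eqn_leq -ET; apply/andP; split.
    by rewrite maxlab_leq; apply/allP => _ /mapP[v vT ->]; apply: label_le_root.
  by apply: label_le_maxlab; apply: map_f.
by rewrite block_nub ?diag_nub // ET.
Qed.

(* The labels on the left path of the root decrease, so the next diagonal
   label below that of v can only be the one of its left child. *)
Lemma diag_below v i : on_diag v -> v \in nodes T -> i < label T v -> i \in B i ->
  exists2 s, lchild v ++ s \in nodes T & label T (lchild v ++ s) = i.
Proof.
move=> dv vT iv iB.
have iT : i \in labels T.
  rewrite (fb_labels fT); apply/andP; split; first by case: i iB {iv}.
  by rewrite (leq_trans (ltnW iv)) // label_le_maxlab // map_f.
have [w wn ew] := nub_label iT.
have wT : w \in nodes T by move: wn; rewrite mem_nub => /andP[].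
have dw : on_diag w by rewrite -block_diag // ew.
case: (leqP (size w) (size v)) => wv.
  have : label T v <= label T w.
    by move: vT; rewrite (on_diag_cat dw dv wv); apply: label_decr.
  by rewrite ew leqNgt iv.
have dl : on_diag (lchild v) by rewrite on_diag_child.
have e : w = lchild v ++ nseq (size w - size (lchild v)) false.
  by apply: on_diag_cat; rewrite // size_rcons.
by exists (nseq (size w - size (lchild v)) false); rewrite -e.
Qed.

(** A node with a repeated label has no left child because [nub] and [asctops] agree. Off the
    diagonal the left child starts the block of [v]; on it, the left child is the next diagonal
    node. *)
Lemma block_attached : attached (attach B) [::] T.
Proof.
apply/(attachedP _ _ sT) => v vT; rewrite cat0s.
case: (boolP (label T v \in before T v)) => [h|h].
  have := fb_nub fT vT; rewrite h /= => /esym/negbT; rewrite negb_or mem_nodes negbK.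
  by move=> /andP[_ /eqP ->].
have vn : v \in nub T by rewrite mem_nub vT.
rewrite /attach block_diag //; case: ifP => dv; last first.
  by rewrite block_nub // /path_head dv.
case: (boolP (lchild v \in nodes T)) => lT; last first.
  have -> : pred_diag B (label T v) = 0.
    apply/eqP; rewrite -leqn0; apply: pred_diag_leq => i iv iB.
    have [s /nodes_prefix] := diag_below dv vT iv iB; by rewrite (negPf lT).
  by move: lT; rewrite mem_nodes negbK => /eqP ->.
have dl : on_diag (lchild v) by rewrite on_diag_child.
have ln : lchild v \in nub T by apply: diag_nub.
have -> : pred_diag B (label T v) = label T (lchild v).
  apply/eqP; rewrite eqn_leq; apply/andP; split.
    apply: pred_diag_leq => i iv iB; have [s sT' <-] := diag_below dv vT iv iB.
    exact: label_decr.
  apply: pred_diag_geq; last by rewrite block_diag.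
  apply: (lchild_lt sT vT); rewrite (sub_node lT) labels_node mem_cat inE eqxx.
  by rewrite orbT.
by rewrite block_nub // /path_head dl.
Qed.

End Reconstruction.

(** The number of blocks gives [maxlab], whose block is the spine of the tree; [attached_inj] does
    the rest. *)
Lemma treeB_inj (T T' : ltree) :
  fishburn_spec T -> fishburn_spec T' -> treeB T = treeB T' -> T = T'.
Proof.
move=> fT fT' e; have em : maxlab T = maxlab T'.
  by move/(congr1 size): e; rewrite !size_map !size_iota.
apply: (attached_inj (block_attached fT)); first by rewrite e block_attached.
by rewrite !block_root // e em.
Qed.

(** * Every list of blocks comes from a Fishburn tree *)

Section Existence.
Variables (k : nat) (B : nat -> seq nat).
Hypothesis B_sorted : forall i, sorted geq (B i).
(** When [pred_diag] is 0, this leaves the lowest diagonal node without a left child. *)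
Hypothesis B0 : B 0 = [::].
Hypothesis B_neq : forall i, 0 < i <= k -> B i != [::].
Hypothesis B_le : forall i a, a \in B i -> 0 < a <= i.
Hypothesis B_cover : forall a, 0 < a <= k -> exists2 i, i <= k & a \in B i.

Let C := attach B.

Lemma attach_lt a b : b \in C a -> 0 < b < a.
Proof.
rewrite /C /attach; case: ifP => aB bB; have := B_le bB.
  have := @pred_diag_lt B a; have := B_le aB; lia.
case/andP=> b0 ba; apply/andP; split=> //.
by rewrite ltn_neqAle ba andbT; apply/eqP => e; rewrite e aB in bB.
Qed.

Section Tree.
Variable T : ltree.
Hypotheses (aT : attached C [::] T) (spT : spine T = B k).

Let dT : decreasing T.
Proof.
apply: (attached_decreasing attach_lt aT); last by rewrite spT.
by move=> a; rewrite /C /attach; case: ifP.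
Qed.

Let sT : strictly_decreasing_left T.
Proof.
apply: (attached_sdl attach_lt aT); rewrite spT.
by apply/allP => a /B_le /andP[].
Qed.

Let leftP v : v \in nodes T -> spine (sub T (lchild v)) =
  if label T v \in before T v then [::] else C (label T v).
Proof. by move=> vT; have /(attachedP _ _ sT)/(_ v vT) := aT. Qed.

Let leftP_nub v : v \in nub T -> spine (sub T (lchild v)) = C (label T v).
Proof. by rewrite mem_nub => /andP[vT h]; rewrite leftP // (negPf h). Qed.

Let head_label v l s : v \in nodes T -> spine (sub T v) = l :: s -> label T v = l.
Proof. by move=> vT; rewrite (sub_node vT) /= => -[]. Qed.

Let head_B i : i \in B i -> exists s, B i = i :: s.
Proof.
move=> iB; have := @B_sorted i; have := iB.
case E: (B i) => [//|a s]; rewrite inE => /orP[/eqP <-|is_]; first by exists s.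
rewrite /= => /order_path_min; have tr : transitive geq by move=> x y z /=; lia.
move=> /(_ tr) /allP /(_ _ is_) /= ia.
have : a \in B i by rewrite E mem_head.
by move/B_le => /andP[_ ai]; exists s; congr cons; lia.
Qed.

Let diag_step v : on_diag v -> v \in nodes T -> spine (sub T v) = B (label T v) ->
  spine (sub T (lchild v)) = B (pred_diag B (label T v)) /\
  (lchild v \in nodes T -> label T (lchild v) = pred_diag B (label T v)).
Proof.
move=> dv vT sv; have := leftP_nub (diag_nub sT dv vT).
have lB : label T v \in B (label T v) by rewrite -sv (sub_node vT) mem_head.
rewrite /C /attach lB => e; split=> // lT.
case: (posnP (pred_diag B (label T v))) => [e0|/pred_diag_mem/head_B[s es]].
  by move: lT; rewrite mem_nodes -spine_nil e e0 B0.
by apply: (@head_label _ _ s) => //; rewrite e es.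
Qed.

Let root_label : [::] \in nodes T -> label T [::] = k.
Proof.
move=> rT; have k0 : 0 < k by case: k spT rT => //; case: (T) => //; rewrite B0.
(* Only [B k] can contain [k], since an entry of [B i] is at most [i]. *)
have [i ik ki] : exists2 i, i <= k & k \in B i by apply: B_cover; rewrite k0 /=.
have ei : i = k by have := B_le ki; lia.
subst i; have [s es] := head_B ki.
by apply: (@head_label _ _ s) => //; rewrite spT.
Qed.

Let diag_spine v : on_diag v -> v \in nodes T -> spine (sub T v) = B (label T v).
Proof.
elim/last_ind: v => [_ rT|v d IH]; first by rewrite root_label.
rewrite -/(child d v) on_diag_child; case: d => //= dv lT.
have vT : v \in nodes T by move: lT; rewrite /child -cats1 => /nodes_prefix.
have [e ->] := diag_step dv vT (IH dv vT); by [].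
Qed.

(** Walk down the diagonal from the root, whose label is [k]: as long as the label exceeds [i], the
    next diagonal label is still at least [i]. *)
Let diag_exists i : 0 < i <= k -> i \in B i ->
  exists v, [/\ on_diag v, v \in nodes T & label T v = i].
Proof.
move=> /andP[i0 ik] iB.
suff h l v : i <= l -> on_diag v -> v \in nodes T -> label T v = l ->
    exists v, [/\ on_diag v, v \in nodes T & label T v = i].
  have rT : [::] \in nodes T.
    have := @B_neq k; rewrite leqnn (leq_trans i0 ik) -spT => /(_ isT).
    by rewrite mem_nodes -spine_nil.
  by apply: (h (label T [::]) [::]); rewrite // root_label.
elim/ltn_ind: l v => l IH v il dv vT lv.
case: (ltngtP i l) il => // [il _|-> _]; last by exists v.
have [e lab] := diag_step dv vT (diag_spine dv vT).
rewrite lv in e lab.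
have ip : i <= pred_diag B l by apply: pred_diag_geq.
have p0 : 0 < pred_diag B l by lia.
have lT : lchild v \in nodes T.
  rewrite mem_nodes -spine_nil e.
  by have [s ->] := head_B (pred_diag_mem p0).
apply: (IH (pred_diag B l) _ (lchild v)); rewrite ?on_diag_child ?lab //.
by apply: pred_diag_lt; lia.
Qed.

Let mem_block v : v \in nub T -> 0 < label T v <= k ->
  (label T v \in B (label T v)) = on_diag v.
Proof.
move=> vn lk; have vT : v \in nodes T by move: vn; rewrite mem_nub => /andP[].
apply/idP/idP => [/(diag_exists lk)[w [dw wT ew]]|dv].
  by rewrite -(nub_inj (diag_nub sT dw wT) vn ew).
by rewrite -(diag_spine dv vT) (sub_node vT) mem_head.
Qed.

Let block_spine v : v \in nub T -> 0 < label T v <= k ->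
  spine (sub T (path_head v)) = B (label T v).
Proof.
move=> vn lk; have vT : v \in nodes T by move: vn; rewrite mem_nub => /andP[].
rewrite /path_head; case: ifP => dv; first exact: diag_spine.
by rewrite leftP_nub // /C /attach mem_block // dv.
Qed.

Let labelsE a : (a \in labels T) = (0 < a <= k).
Proof.
apply/idP/idP => [|]; first move: a; first apply/allP.
  apply: (attached_all aT) => [a /andP[a0 ak]|].
    by apply/allP => b /attach_lt; lia.
  by rewrite spT; apply/allP => b /B_le.
(* Downward induction from [k]: [a] occurs in some [B i] with [a <= i]. If [i = a], then [a] is
   diagonal; otherwise [i] is already known to be a label, and its first node carries the path
   [B i]. *)
have [n] := ubnP (k - a); elim: n a => // n IH a hn ak.
have [i ik ai] := B_cover ak; have := B_le ai => /andP[a0].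
rewrite leq_eqVlt => /orP[/eqP e|lt].
  subst i; have [v [_ vT <-]] := diag_exists ak ai; exact: map_f.
have ik' : 0 < i <= k by lia.
have [v vn ev] : exists2 v, v \in nub T & label T v = i.
  by apply: nub_label; apply: IH => //; lia.
apply: (@subtree_mem _ (path_head v)); apply: spine_mem.
by rewrite block_spine ?ev.
Qed.

Let maxlabE : maxlab T = k.
Proof.
apply/eqP; rewrite eqn_leq maxlab_leq; apply/andP; split.
  by apply/allP => a; rewrite labelsE => /andP[].
by case: (posnP k) => [->//|k0]; apply: label_le_maxlab; rewrite labelsE k0 /=.
Qed.

Lemma attached_fishburn : fishburn_spec T.
Proof.
split=> // [a|v vT]; first by rewrite labelsE maxlabE.
have vk : 0 < label T v <= k by rewrite -labelsE map_f.
apply/idP/idP => [vn|/orP[dv|lT]].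
(* A first occurrence off the diagonal has a left child because its block is nonempty. *)
- have {}vn : v \in nub T by rewrite mem_nub vT.
  case: (boolP (on_diag v)) => //= dv.
  have := block_spine vn vk; rewrite /path_head (negPf dv) => e.
  by rewrite mem_nodes -spine_nil e B_neq.
- by have := diag_nub sT dv vT; rewrite mem_nub => /andP[].
- by move: lT; rewrite mem_nodes -spine_nil leftP //; case: ifP.
Qed.

Lemma attached_treeB : treeB T = [seq seq_mset (B i) | i <- iota 1 k].
Proof.
rewrite /treeB maxlabE; apply/eq_in_map => i; rewrite mem_iota add1n ltnS => ik.
have [v vn ev] : exists2 v, v \in nub T & label T v = i.
  by apply: nub_label; rewrite labelsE.
by rewrite -ev W_labels ?block_spine ?ev //; apply: attached_fishburn.
Qed.

End Tree.

Lemma fishburn_exists :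
  exists T : fishburn, treeB T = [seq seq_mset (B i) | i <- iota 1 k].
Proof.
have [T aT sT] := attached_exists attach_lt [::] (B k).
have /fishburnP fT := attached_fishburn aT sT.
by exists (Fishburn fT); apply: attached_treeB.
Qed.

End Existence.

(** * The right paths partition the nodes *)

Lemma right_path_split (u : node) :
  exists w j, u = w ++ nseq j true /\ forall x, w != rchild x.
Proof.
elim/last_ind: u => [|u d [w [j [-> hw]]]].
  by exists [::], 0; split=> // x; case: x.
case: d.
  exists w, j.+1; split=> //.
  by rewrite -!iter_child.
exists (lchild (w ++ nseq j true)), 0; split; first by rewrite cats0.
by move=> x; apply: lchild_neq_rchild.
Qed.

Lemma right_path_inj (w w' : node) j j' :
  (forall x, w != rchild x) -> (forall x, w' != rchild x) ->
  w ++ nseq j true = w' ++ nseq j' true -> w = w'.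
Proof.
rewrite -!iter_child => hw hw'; elim: j j' => [|j IH] [|j'] //=.
- by move=> e; move: (hw (iter j' rchild w')); rewrite e eqxx.
- by move=> e; move: (hw' (iter j rchild w)); rewrite e eqxx.
- by move=> /rcons_inj[/IH].
Qed.

Lemma path_head_inj : injective path_head.
Proof.
move=> v w; rewrite /path_head; case: ifP => dv; case: ifP => dw //.
- by move=> e; rewrite e on_diag_child dw in dv.
- by move=> e; rewrite -e on_diag_child dv in dw.
- by move=> /rcons_inj[].
Qed.

Section Partition.
Variable T : ltree.
Hypothesis fT : fishburn_spec T.

Lemma mem_W v u : v \in nub T ->
  (u \in W T (label T v)) <->
  (exists2 j, u = path_head v ++ nseq j true & u \in nodes T).
Proof.
move=> vn; rewrite W_nub // trajectE; split.
  move=> /mapP[j]; rewrite mem_iota /= => jp ->; exists j => //.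
  by rewrite nodes_cat nseq_in_nodes.
case=> j ->; rewrite nodes_cat nseq_in_nodes => jp; apply/mapP; exists j => //.
by rewrite mem_iota.
Qed.

(** The right path through [u] starts at a node that is no right child: either a diagonal node,
    which is in [nub T], or the left child of an off-diagonal node, which is in [asctops T] and
    hence in [nub T]. *)
Lemma W_cover u : u \in nodes T -> exists2 v, v \in nub T & u \in W T (label T v).
Proof.
have [w [j [-> hw]]] := right_path_split u => uT.
have wT := nodes_prefix uT.
suff [v vn ew] : exists2 v, v \in nub T & path_head v = w.
  by exists v => //; apply/mem_W => //; exists j; rewrite // ew.
case: (boolP (on_diag w)) => dw.
  exists w; first exact: diag_nub (fb_sdl fT) dw wT.
  by rewrite /path_head dw.
case/lastP: w wT dw hw {uT} => [//|v []]; first by move=> _ _ /(_ v)/eqP.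
rewrite -/(child false v) on_diag_child /= => lT dv _.
have vT : v \in nodes T by move: lT; rewrite /child -cats1 => /nodes_prefix.
exists v; last by rewrite /path_head (negPf dv).
by rewrite -fb_asctops // mem_asctops vT lT orbT.
Qed.

Lemma W_disjoint v w u : v \in nub T -> w \in nub T ->
  u \in W T (label T v) -> u \in W T (label T w) -> v = w.
Proof.
move=> vn wn /(mem_W _ vn)[i -> _] /(mem_W _ wn)[j + _] => e; apply: path_head_inj.
by apply: right_path_inj e; apply: path_head_neq.
Qed.

Lemma blab_spec u : u \in nodes T ->
  0 < blab T u <= maxlab T /\ u \in W T (blab T u).
Proof.
move=> uT; have [v vn uW] := W_cover uT.
have : label T v \in labels T by apply: map_f; move: vn; rewrite mem_nub => /andP[].
rewrite (fb_labels fT) => lv.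
have hs : has (fun i => u \in W T i) (iota 1 (maxlab T)).
  by apply/hasP; exists (label T v); rewrite // mem_iota add1n ltnS.
have := nth_find 0 hs; move: hs; rewrite has_find size_iota => hs.
by rewrite nth_iota // add1n -/(blab T u) => ->; split.
Qed.

Lemma mem_W_blab u i : 0 < i <= maxlab T ->
  (u \in W T i) = (u \in nodes T) && (blab T u == i).
Proof.
rewrite -(fb_labels fT) => iT; have [v vn ei] := nub_label iT; subst i.
apply/idP/andP => [uW|[uT /eqP <-]]; last by case: (blab_spec uT).
have uT : u \in nodes T by case/(mem_W _ vn): uW.
split=> //; have [hb uWb] := blab_spec uT.
move: hb; rewrite -(fb_labels fT) => bT; have [w wn ew] := nub_label bT.
by rewrite -ew in uWb *; rewrite (W_disjoint vn wn uW uWb).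
Qed.

End Partition.

(** The common shape of [treeB] and [posetB], with both labelings as parameters. *)
Definition blocks (V : eqType) (s : seq V) (l b : V -> nat) (k : nat) :=
  [seq seq_mset [seq l u | u <- s & b u == i] | i <- iota 1 k].

Lemma blocks_map (V V' : eqType) (f : V -> V') s s' l b k :
  perm_eq (map f s) s' -> blocks s (l \o f) (b \o f) k = blocks s' l b k.
Proof.
move=> p; apply: eq_map => i; apply/eq_seq_msetP.
have -> : [seq (l \o f) u | u <- s & (b \o f) u == i]
          = [seq l u | u <- [seq f u | u <- s] & b u == i].
  by rewrite filter_map -map_comp.
by rewrite perm_map // perm_filter.
Qed.

Lemma treeB_blocks T : fishburn_spec T ->
  treeB T = blocks (nodes T) (label T) (blab T) (maxlab T).
Proof.
move=> fT; apply/eq_in_map => i; rewrite mem_iota add1n ltnS => ik.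
apply/eq_seq_msetP/perm_map/uniq_perm.
- have : i \in labels T by rewrite fb_labels.
  move/nub_label => [v vn <-]; rewrite W_nub // trajectE map_inj_uniq ?iota_uniq //.
  by move=> a c /(congr1 size); rewrite !size_cat !size_nseq; lia.
- by rewrite filter_uniq // uniq_nodes.
- by move=> u; rewrite mem_W_blab // mem_filter andbC.
Qed.

(** * Representations of a poset by two labelings *)

(** For a strict order, this is an interval representation with endpoints [l u] and [b u]; that both
    run over all of [[k]] makes it canonical. *)
Record representation (V : Type) (r : rel V) (l b : V -> nat) (k : nat) : Prop :=
  Representation {
    rep_lt : forall u v, r u v = (b u < l v);
    rep_l : forall u, 0 < l u <= k;
    rep_b : forall u, 0 < b u <= k;
    rep_l_onto : forall i, 0 < i <= k -> exists u, l u = i;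
    rep_b_onto : forall i, 0 < i <= k -> exists u, b u = i }.

Lemma find_ltn m n : m < n -> find (ltn m) (iota 1 n) = m.
Proof.
move=> mn; rewrite -(subnKC (ltnW mn)) iotaD find_cat size_iota.
have -> : has (ltn m) (iota 1 m) = false.
  by apply/hasP => -[i]; rewrite mem_iota /=; lia.
by case: (n - m) (subn_gt0 m n) => [|p _] /=; rewrite ?mn // add1n ltnSn addn0.
Qed.

Lemma mem_downsets d (Q : finPOrderType d) (A : {set Q}) :
  reflect (exists u, A = downset u) (A \in downsets Q).
Proof.
rewrite mem_sort mem_enum; apply: (iffP imsetP) => [[u _ ->]|[u ->]]; first by exists u.
by exists u; rewrite // classical_sets.in_setT.
Qed.

Lemma uniq_downsets d (Q : finPOrderType d) : uniq (downsets Q).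
Proof. by rewrite sort_uniq enum_uniq. Qed.

Section Unique.
Variables (d : Order.disp_t) (Q : finPOrderType d) (l b : Q -> nat) (k : nat).
Hypothesis rQ : representation (@Order.lt d Q) l b k.

Let D i : {set Q} := [set v | b v < i]%SET.

Let D_mono i j : i <= j -> D i \subset D j.
Proof. by move=> ij; apply/subsetP => v; rewrite !inE => /leq_trans; apply. Qed.

Let D_inj : {in iota 1 k &, injective D}.
Proof.
move=> i j; wlog ij : i j / i <= j.
  by move=> th ik jk e; case/orP: (leq_total i j) => h; [|apply/esym]; apply: th.
rewrite !mem_iota !add1n !ltnS => ik jk e; apply/eqP; rewrite eqn_leq ij /= leqNgt.
apply/negP => lt; have [u bu] := rep_b_onto rQ ik.
by have /setP/(_ u) := e; rewrite !inE bu ltnn lt.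
Qed.

Let downsetE u : downset u = D (l u).
Proof. by apply/setP => v; rewrite !inE (rep_lt rQ). Qed.

Let uniq_D : uniq [seq D i | i <- iota 1 k].
Proof. by rewrite map_inj_in_uniq ?iota_uniq. Qed.

(** Both lists are increasing for inclusion and have the same members; every [D i] is a down-set
    because [l] is onto. *)
Let downsetsE : downsets Q = [seq D i | i <- iota 1 k].
Proof.
pose le (A B : {set Q}) := A \subset B.
have le_tr : transitive le by move=> A B C; apply: subset_trans.
apply: (@sorted_eq _ le le_tr).
- by move=> A B AB; apply/eqP; rewrite eqEsubset.
- apply: (@sort_sorted_in _ [in downsets Q] le); last first.
    by apply/allP => A; rewrite /= mem_sort.
  move=> A B /mem_downsets[u ->] /mem_downsets[v ->]; rewrite !downsetE /le.
  by case/orP: (leq_total (l u) (l v)) => /D_mono ->; rewrite ?orbT.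
- rewrite sorted_map; apply: (@sub_sorted _ leq); last exact: iota_sorted.
  by move=> i j; apply: D_mono.
- apply: uniq_perm => //; first exact: uniq_downsets.
  move=> A; apply/mem_downsets/mapP => [[u ->]|[i]].
    by exists (l u); rewrite ?downsetE // mem_iota add1n ltnS (rep_l rQ).
  rewrite mem_iota add1n ltnS => /(rep_l_onto rQ)[u <-] ->.
  by exists u; rewrite ?downsetE.
Qed.

Lemma rep_size : size (downsets Q) = k.
Proof. by rewrite downsetsE size_map size_iota. Qed.

Let DsetE i : 0 < i <= k.+1 -> Dset Q i = D i.
Proof.
rewrite /Dset downsetsE; case: i => // i /=; rewrite ltnS leq_eqVlt => /orP[/eqP ->|ik].
  (* For index [k + 1] the default value [Q] agrees with [D k.+1], since [b] is at most [k]. *)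
  rewrite nth_default ?size_map ?size_iota //.
  by apply/setP => v; rewrite !inE ltnS; case/andP: (rep_b rQ v).
by rewrite (nth_map 0) ?size_iota // nth_iota.
Qed.

Lemma rep_lev u : lev u = l u.
Proof.
rewrite /lev downsetE downsetsE; have := rep_l rQ u; case: (l u) => // i /= ik.
have -> : D i.+1 = nth (D 0) [seq D i | i <- iota 1 k] i.
  by rewrite (nth_map 0) ?size_iota // nth_iota.
by rewrite index_uniq // size_map size_iota.
Qed.

Lemma rep_bpos u : bpos u = b u.
Proof.
rewrite /bpos rep_size; have /andP[_ bk] := rep_b rQ u.
(* The search stops at the first index above [b u]; it sits at position [b u] of the list, and the
   predecessor in [bpos] undoes the shift. *)
have -> : find (fun i => u \in Dset Q i) (iota 1 k.+1) = b u.
  rewrite -[RHS](@find_ltn _ k.+1) //; apply: eq_in_find => i.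
  by rewrite mem_iota add1n ltnS => ik; rewrite DsetE // inE.
by rewrite nth_iota.
Qed.

Lemma rep_posetB : posetB Q = blocks (enum Q) l b k.
Proof.
rewrite /posetB rep_size; apply: eq_map => i; congr seq_mset.
rewrite (eq_map rep_lev); congr map; apply: eq_filter => u.
by rewrite rep_bpos.
Qed.

End Unique.

Section Free.
Variables (d : Order.disp_t) (Q : finPOrderType d).

(** For chains [x < y] and [x' < y'] with no relation between them,
    [b x < l y <= b x' < l y' <= b x]. *)
Lemma rep_free (l b : Q -> nat) k :
  representation (@Order.lt d Q) l b k -> poset_free Q.
Proof.
move=> rQ; apply/negP => /existsP[f /andP[_ /forallP h]].
have h' x y := eqP (forallP (h x) y).
have := h' (true, false) (true, true); have := h' (false, false) (false, true).
have := h' (true, false) (false, true); have := h' (false, false) (true, true).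
rewrite /two_plus_two /= !(rep_lt rQ); lia.
Qed.

Hypothesis free : poset_free Q.

Let k := size (downsets Q).

(** Witnesses [x < u] and [y < v] against the two inclusions form an induced 2+2: any relation
    between the two chains yields [x < v] or [y < u] by transitivity. *)
Lemma downset_total (u v : Q) :
  (downset u \subset downset v) || (downset v \subset downset u).
Proof.
apply: contraT; rewrite negb_or => /andP[/subsetPn[x xu xv] /subsetPn[y yv yu]].
rewrite !inE in xu xv yv yu.
have lxv : (x < v)%O = false by apply: negbTE.
have lyu : (y < u)%O = false by apply: negbTE.
have lux : (u < x)%O = false := lt_gtF xu.
have lvy : (v < y)%O = false := lt_gtF yv.
have luv : (u < v)%O = false by apply: contraNF xv; apply: lt_trans.
have lvu : (v < u)%O = false by apply: contraNF yu; apply: lt_trans.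
have luy : (u < y)%O = false by apply: contraFF luv => /lt_trans; apply.
have lvx : (v < x)%O = false by apply: contraFF lvu => /lt_trans; apply.
have lxy : (x < y)%O = false by apply: contraFF lxv => /lt_trans; apply.
have lyx : (y < x)%O = false by apply: contraFF lyu => /lt_trans; apply.
case/negP: free; apply/existsP.
exists [ffun p : bool * bool =>
          if p.1 then (if p.2 then u else x) else (if p.2 then v else y)].
apply/andP; split.
  have lt1 : (x < u)%O = true by []. have lt2 : (y < v)%O = true by [].
  have lxx := ltxx x; have lyy := ltxx y.
  by apply/injectiveP => -[[] []] [[] []]; rewrite !ffunE //=; congruence.
by apply/forallP => -[[] []]; apply/forallP => -[[] []];
  rewrite !ffunE /two_plus_two /= ?ltxx ?xu ?yv ?lxv ?lyu ?lux ?lvy ?luv ?lvu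
    ?luy ?lvx ?lxy ?lyx.
Qed.

Let sub_leq i j : i <= j -> Dset Q i \subset Dset Q j.
Proof.
move=> ij; rewrite /Dset.
have ij' : i.-1 <= j.-1 by lia.
case: (ltnP j.-1 k) => jk; last by rewrite [nth _ _ j.-1]nth_default ?subsetT.
pose le (A B : {set Q}) := A \subset B.
apply: (@sorted_leq_nth _ le) => //; rewrite ?inE //; last exact: leq_ltn_trans jk.
- by move=> A B C; apply: subset_trans.
- by move=> A; apply: subxx.
- apply: (@sort_sorted_in _ [in downsets Q] le); last first.
    by apply/allP => A; rewrite /= mem_sort.
  by move=> A B /mem_downsets[u ->] /mem_downsets[v ->]; apply: downset_total.
Qed.

Let downset_mem (u : Q) : downset u \in downsets Q.
Proof. by apply/mem_downsets; exists u. Qed.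

Let lev_range (u : Q) : 0 < lev u <= k.
Proof. by rewrite /lev /= index_mem downset_mem. Qed.

Let Dset_lev (u : Q) : Dset Q (lev u) = downset u.
Proof. by rewrite /Dset /lev nth_index ?downset_mem. Qed.

Let Dset_ex i : 0 < i <= k -> exists u : Q, lev u = i /\ Dset Q i = downset u.
Proof.
case: i => // i /= ik.
have /mem_downsets[u eu] : nth setT (downsets Q) i \in downsets Q by apply: mem_nth.
exists u; split; last exact: eu.
by rewrite /lev -eu index_uniq // uniq_downsets.
Qed.

Let bpos_spec (u : Q) i : 0 < i <= k.+1 -> (u \in Dset Q i) = (bpos u < i).
Proof.
move=> ik; rewrite /bpos -/k; set p := fun i => _; set s := iota _ _.
(* The search succeeds at [k.+1] at the latest, where [Dset] falls back to all of [Q]. *)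
have hs : has p s.
  apply/hasP; exists k.+1; first by rewrite mem_iota add1n ltnS leqnn.
  by rewrite /p /Dset nth_default ?inE.
have fs : find p s < k.+1 by rewrite -[k.+1](size_iota 1) -has_find.
have := nth_find 0 hs; rewrite nth_iota // add1n succnK => pf.
apply/idP/idP => [ui|fi].
  rewrite ltnNge; apply/negP => fi.
  have lt : i.-1 < find p s by lia.
  have := before_find 0 lt; rewrite nth_iota; last by lia.
  by rewrite add1n prednK ?/p ?ui //; case/andP: ik.
by apply: subsetP pf; apply: sub_leq.
Qed.

Lemma free_rep : representation (@Order.lt d Q) (@lev d Q) (@bpos d Q) k.
Proof.
have ltE (u v : Q) : (u < v)%O = (bpos u < lev v).
  by rewrite -bpos_spec ?Dset_lev ?inE //; have := lev_range v; lia.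
(* If [bpos u] were 0, [u] would lie in [D_1], hence in [D_(lev u)], its own strict down-set. *)
have b0 (u : Q) : 0 < bpos u.
  rewrite ltnNge leqn0; apply/negP => /eqP e.
  have [w [w1 ew]] : exists w : Q, lev w = 1 /\ Dset Q 1 = downset w.
    by apply: Dset_ex; have := lev_range u; lia.
  have : u \in Dset Q 1 by rewrite bpos_spec // e.
  have /subsetP h : Dset Q 1 \subset Dset Q (lev u).
    by apply: sub_leq; case/andP: (lev_range u).
  by move/h; rewrite Dset_lev inE ltxx.
have bk (u : Q) : bpos u <= k.
  by rewrite -ltnS -bpos_spec ?leqnn // /Dset nth_default ?inE.
split=> // [u|i ik|i ik]; first by rewrite b0 bk.
  by have [u [eu _]] := Dset_ex ik; exists u.
(* [bpos] takes the value [i] exactly on the difference of [D_(i+1)] and [D_i]. *)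
suff [u uD uN] : exists2 u, u \in Dset Q i.+1 & u \notin Dset Q i.
  by exists u; rewrite bpos_spec in uD; last lia; rewrite bpos_spec in uN; lia.
have [v [lv ev]] := Dset_ex ik.
(* For [i = k] any [v] of level [k] will do, as [D_(k+1) = Q]; for [i < k] consecutive down-sets are
   distinct. *)
case: (ltngtP i k) => [ltik||eik]; last first.
- exists v; last by rewrite ev inE ltxx.
  by rewrite /Dset nth_default ?inE //= eik.
- by lia.
have [w [lw ew]] : exists w : Q, lev w = i.+1 /\ Dset Q i.+1 = downset w.
  by apply: Dset_ex.
have : Dset Q i != Dset Q i.+1.
  by apply/eqP; rewrite ev ew => e; move: lw; rewrite /lev -e -/(lev v) lv; lia.
rewrite eqEsubset sub_leq //= => /subsetPn[u uD uN]; by exists u.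
Qed.

End Free.

(** * The two maps *)

Lemma fishburn_ok (T : fishburn) : fishburn_spec T.
Proof. by apply/fishburnP; case: T. Qed.

Lemma gamma_rep (T : fishburn) :
  representation (@Order.lt _ (gamma T)) (fun u => label T (ssval u))
    (fun u => blab T (ssval u)) (maxlab T).
Proof.
have fT := fishburn_ok T; split=> [//|u|u|i|i] /=.
- by rewrite -(fb_labels fT); apply: map_f; apply: ssvalP.
- by have [] := blab_spec fT (ssvalP u).
- by rewrite -(fb_labels fT) => /mapP[v vT ->]; exists (SeqSub vT).
move=> ik; have /nub_label[v vn ei] : i \in labels T by rewrite (fb_labels fT).
(* Block [i] is nonempty: it contains the start of its path. *)
have : path_head v \in W T i.
  by rewrite -ei; apply/mem_W => //; exists 0; rewrite ?cats0 ?path_head_in.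
rewrite mem_W_blab // => /andP[hT /eqP e]; by exists (SeqSub hT).
Qed.

Lemma perm_enum_gamma (T : fishburn) :
  perm_eq [seq ssval u | u <- enum {: gamma T}] (nodes T).
Proof.
have inj : injective (fun u : gamma T => ssval u).
  by move=> [x xT] [y yT] /= e; subst y; congr SeqSub; apply: bool_irrelevance.
apply: uniq_perm; [by rewrite (map_inj_uniq inj) enum_uniq | exact: uniq_nodes |].
move=> v; apply/mapP/idP => [[u _ ->]|vT]; first exact: ssvalP.
by exists (SeqSub vT); rewrite ?mem_enum.
Qed.

Lemma card_gamma (T : fishburn) : #|{: gamma T}| = tree_size T.
Proof. by rewrite /tree_size -(perm_size (perm_enum_gamma T)) size_map cardE. Qed.

Lemma posetB_gamma (T : fishburn) : posetB (gamma T) = treeB T.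
Proof.
rewrite (rep_posetB (gamma_rep T)) (treeB_blocks (fishburn_ok T)).
exact/blocks_map/perm_enum_gamma.
Qed.

Lemma gammabarE d (Q : finPOrderType d) (T : fishburn) :
  treeB T = posetB Q -> gammabar Q = T.
Proof.
move=> e; apply: xget_unique => // T' /= e'; apply: val_inj => /=.
by apply: treeB_inj; rewrite ?e ?e' //; apply: fishburn_ok.
Qed.

Lemma gammaK (T : fishburn) : gammabar (gamma T) = T.
Proof. by apply: gammabarE; rewrite posetB_gamma. Qed.

(** The representation by [lev] and [bpos] has what [fishburn_exists] asks of the blocks: [bpos]
    onto makes them nonempty, [lev] onto makes them cover [[k]]. *)
Lemma treeB_gammabar d (Q : finPOrderType d) :
  poset_free Q -> treeB (gammabar Q) = posetB Q.
Proof.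
move=> /free_rep rQ; set k := size _ in rQ.
pose B i := sort geq [seq lev u | u <- enum Q & bpos u == i].
have memB i a : reflect (exists2 u : Q, bpos u = i & lev u = a) (a \in B i).
  rewrite mem_sort; apply: (iffP mapP) => [[u]|[u bu <-]].
    by rewrite mem_filter => /andP[/eqP bu _] ->; exists u.
  by exists u; rewrite // mem_filter bu eqxx mem_enum.
have [|||||T eT] := @fishburn_exists k B.
- by move=> i; apply: sort_sorted => x y /=; lia.
- case E : (B 0) => [//|a s]; have : a \in B 0 by rewrite E mem_head.
  by case/memB => u bu; have := rep_b rQ u; rewrite bu.
- move=> i /(rep_b_onto rQ)[u bu]; apply/eqP => e.
  have : lev u \in B i by apply/memB; exists u.
  by rewrite e.
- move=> i a /memB[u <- <-]; have /andP[-> _] := rep_l rQ u.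
  (* [lev u <= bpos u] restates that [u < u] fails. *)
  rewrite /= leqNgt -(rep_lt rQ) ltxx //.
- move=> a /(rep_l_onto rQ)[u <-]; exists (bpos u); last by apply/memB; exists u.
  by case/andP: (rep_b rQ u).
have eQ : treeB T = posetB Q.
  rewrite eT; apply: eq_map => i; apply/eq_seq_msetP.
  by rewrite perm_sort.
by rewrite (gammabarE eQ).
Qed.

(** [perm_iotaP] supplies a permutation [Is] of positions matching the two lists of values, and [h]
    moves elements along it. *)
Lemma perm_bijection (X Y : finType) (E : eqType) (f : X -> E) (g : Y -> E) :
  perm_eq [seq f x | x <- enum X] [seq g y | y <- enum Y] ->
  exists2 h : {ffun X -> Y}, bijective h & forall x, g (h x) = f x.
Proof.
move=> p; have cXY : #|X| = #|Y|.
  by rewrite !cardT -(size_map f) (perm_size p) size_map.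
(* An element [y0] serves as default for [nth]; without one, both types are empty. *)
case: (pickP Y) => [y0 _|noY].
  case: (pickP X) => [x0 _|noX]; last first.
    by have := max_card (pred1 y0); rewrite card1 -cXY eq_card0.
  have [Is pI eI] := perm_iotaP (g y0) p.
  rewrite size_map in pI.
  have sI : size Is = size (enum X).
    by rewrite (perm_size pI) size_iota -!cardE cXY.
  pose h x := nth y0 (enum Y) (nth 0 Is (index x (enum X))).
  have ix x : index x (enum X) < size Is by rewrite sI index_mem mem_enum.
  have nI x : nth 0 Is (index x (enum X)) < size (enum Y).
    by have := mem_nth 0 (ix x); rewrite (perm_mem pI) mem_iota.
  have uI : uniq Is by rewrite (perm_uniq pI) iota_uniq.
  exists (finfun h) => [|x]; last first.
    rewrite ffunE /h -(nth_map y0 (g y0) g) ?nI //.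
    rewrite -(nth_map 0 (g y0) (nth (g y0) [seq g y | y <- enum Y])) // -eI.
    by rewrite (nth_map x0) ?nth_index ?mem_enum // -sI.
  apply: inj_card_bij; last by rewrite cXY.
  move=> x x'; rewrite !ffunE /h => /eqP.
  rewrite nth_uniq ?enum_uniq ?nI // nth_uniq // => /eqP e.
  by rewrite -(nth_index x (mem_enum X x)) e nth_index ?mem_enum.
have noX (x : X) : False.
  by have := max_card (pred1 x); rewrite card1 cXY eq_card0.
exists [ffun x => match noX x with end] => [|x]; last by case: (noX x).
by apply: inj_card_bij; rewrite ?cXY // => x; case: (noX x).
Qed.

Lemma rel_isoP (V V' : finType) (r : rel V) (s : rel V') :
  reflect (exists2 h : V -> V', bijective h & forall x y, s (h x) (h y) = r x y)
          (rel_iso r s).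
Proof.
apply: (iffP existsP) => [[f /and3P[/injectiveP fi /forallP fc /forallP fr]]|[h hb hr]].
  exists f; last by move=> x y; apply/eqP; apply: (forallP (fr x)).
  apply: inj_card_bij => //; rewrite -(card_codom fi).
  by apply/subset_leq_card/subsetP => z _; apply: fc.
exists (finfun h); apply/and3P; split.
- by apply/injectiveP => x y; rewrite !ffunE; apply: bij_inj.
- apply/forallP => z; case: hb => g _ gK; apply/codomP; exists (g z).
  by rewrite ffunE gK.
- by apply/forallP => x; apply/forallP => y; rewrite !ffunE hr.
Qed.

(** The multiplicity of [(a, i)] is that of [a] in block [i]; indices outside [[k]] occur on neither
    side. *)
Lemma blocks_perm (V V' : eqType) (s : seq V) (s' : seq V') l b l' b' k :
  {in s, forall u, 0 < b u <= k} -> {in s', forall u, 0 < b' u <= k} ->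
  blocks s l b k = blocks s' l' b' k ->
  perm_eq [seq (l u, b u) | u <- s] [seq (l' u, b' u) | u <- s'].
Proof.
move=> hb hb' e; apply/allP => -[a i] _ /=; rewrite !count_map.
have cnt (U : eqType) (t : seq U) (m c : U -> nat) :
    count (preim (fun u => (m u, c u)) (pred1 (a, i))) t
    = count_mem a [seq m u | u <- t & c u == i].
  by rewrite count_map count_filter; apply: eq_count => u /=; rewrite xpair_eqE.
rewrite !cnt; case: (boolP (0 < i <= k)) => ik.
  have e' := congr1 (fun t => nth mset0 t i.-1) e.
  move: e'; rewrite !(nth_map 0) ?size_iota; try lia.
  rewrite nth_iota; last by lia.
  rewrite add1n prednK; last by lia.
  by move/eq_seq_msetP/permP => ->.
have none (U : eqType) (t : seq U) (m c : U -> nat) :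
    {in t, forall u, 0 < c u <= k} -> [seq m u | u <- t & c u == i] = [::].
  move=> h; rewrite (_ : filter _ _ = [::]) //; apply/eqP.
  rewrite -[_ == _]negbK -has_filter; apply/hasPn => u /h.
  by apply: contraTN => /eqP ->.
by rewrite !none.
Qed.

(** Equal blocks give a bijection preserving the pair of labels, from which the relation is read
    off. *)
Lemma rep_iso (V V' : finType) (r : rel V) (r' : rel V') l b l' b' k k' :
  representation r l b k -> representation r' l' b' k' ->
  blocks (enum V) l b k = blocks (enum V') l' b' k' -> rel_iso r r'.
Proof.
move=> rV rV' e; have ek : k = k'.
  by have := congr1 size e; rewrite !size_map !size_iota.
subst k'; have [||h hb hE] := perm_bijection (blocks_perm _ _ e).
- by move=> u _; apply: rep_b rV u.
- by move=> u _; apply: rep_b rV' u.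
apply/rel_isoP; exists h => // x y; rewrite (rep_lt rV) (rep_lt rV').
by case: (hE x) => _ ->; case: (hE y) => -> _.
Qed.

Lemma gammabarK d (Q : finPOrderType d) :
  poset_free Q -> poset_iso (gamma (gammabar Q)) Q.
Proof.
move=> fQ; apply: rep_iso (gamma_rep _) (free_rep fQ) _.
by rewrite -(rep_posetB (gamma_rep _)) posetB_gamma treeB_gammabar.
Qed.

Lemma rel_iso_card (V V' : finType) (r : rel V) (s : rel V') :
  rel_iso r s -> #|V| = #|V'|.
Proof. by case/rel_isoP => h /bij_eq_card. Qed.

(** Composing the representation of [Q'] with the isomorphism represents [Q]; as representations are
    unique, it computes [posetB Q]. *)
Lemma gammabar_iso d d' (Q : finPOrderType d) (Q' : finPOrderType d') :
  poset_free Q' -> poset_iso Q Q' -> gammabar Q = gammabar Q'.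
Proof.
move=> fQ' /rel_isoP[h hb hr]; apply: gammabarE; rewrite treeB_gammabar //.
have rQ' := free_rep fQ'; have [g hK gK] := hb.
have rQ : representation (@Order.lt d Q) (@lev _ Q' \o h) (@bpos _ Q' \o h)
            (size (downsets Q')).
  split=> [u v|u|u|i /(rep_l_onto rQ')[u eu]|i /(rep_b_onto rQ')[u eu]] /=.
  - by rewrite -(rep_lt rQ') hr.
  - exact: rep_l rQ' _.
  - exact: rep_b rQ' _.
  - by exists (g u); rewrite gK.
  - by exists (g u); rewrite gK.
rewrite (rep_posetB rQ) (rep_posetB rQ'); apply/esym/blocks_map.
apply: uniq_perm; rewrite ?enum_uniq //.
  by rewrite map_inj_uniq ?enum_uniq //; exact: bij_inj hb.
by move=> u; rewrite [RHS]mem_enum; apply/mapP; exists (g u); rewrite ?mem_enum ?gK.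
Qed.

Lemma size_gammabar d (Q : finPOrderType d) :
  poset_free Q -> tree_size (gammabar Q) = #|Q|.
Proof. by move=> /gammabarK /rel_iso_card <-; rewrite card_gamma. Qed.

Lemma poset_iso_gammabar d d' (Q : finPOrderType d) (Q' : finPOrderType d') :
  poset_free Q -> poset_free Q' -> poset_iso Q Q' = (gammabar Q == gammabar Q').
Proof.
move=> fQ fQ'; apply/idP/eqP => [|e]; first exact: gammabar_iso.
have /rel_isoP[h hb hr] := gammabarK fQ; have /rel_isoP[h' hb' hr'] := gammabarK fQ'.
move: h' hb' hr'; rewrite -e => h' hb' hr'; have [g hK gK] := hb.
apply/rel_isoP; exists (h' \o g); first exact: bij_comp hb' (Bijective gK hK).
by move=> x y /=; rewrite hr' -hr !gK.
Qed.

(** * Counting *)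

Section OrdinalPoset.
Variable n : nat.

(** A copy of ['I_n] tagged by the proof [sr], so that it can carry the order [r] instead of the
    usual one. *)
Definition ord_poset (r : {set 'I_n * 'I_n}) (sr : strict_order (rel_of r)) : Type :=
  'I_n.

Variables (r : {set 'I_n * 'I_n}) (sr : strict_order (rel_of r)).

Lemma strict_order_irr : irreflexive (rel_of r).
Proof. by move=> x; case/andP: sr => /forallP /(_ x) /negbTE. Qed.

Lemma strict_order_trans : transitive (rel_of r).
Proof.
move=> y x z xy yz; case/andP: sr => _ /forallP /(_ x) /forallP /(_ y) /forallP /(_ z).
by rewrite xy yz.
Qed.

HB.instance Definition _ := Finite.copy (ord_poset sr) 'I_n.
HB.instance Definition _ :=
  Order.Lt_isPOrder.Build gamma_display (ord_poset sr)
    strict_order_irr strict_order_trans.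

End OrdinalPoset.

Definition free_rels (n : nat) : {set {set 'I_n * 'I_n}} :=
  [set r | strict_order (rel_of r) & two_two_free (rel_of r)].

Definition rel_tree n (r : {set 'I_n * 'I_n}) : fishburn :=
  if @idP (strict_order (rel_of r)) is ReflectT sr
  then gammabar (ord_poset sr) else empty_fishburn.

Lemma free_relsP n (r : {set 'I_n * 'I_n}) : r \in free_rels n ->
  exists2 sr : strict_order (rel_of r), poset_free (ord_poset sr)
    & rel_tree r = gammabar (ord_poset sr).
Proof.
rewrite inE => /andP[h fr]; rewrite /rel_tree; case: {-}_ / idP => // sr.
by exists sr.
Qed.

Lemma rel_tree_eq n : {in free_rels n &, forall r s,
  rel_iso (rel_of r) (rel_of s) = (rel_tree r == rel_tree s)}.
Proof.
move=> r s /free_relsP[sr fr ->] /free_relsP[ss fs ->].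
by rewrite -poset_iso_gammabar.
Qed.

Lemma size_rel_tree n (r : {set 'I_n * 'I_n}) :
  r \in free_rels n -> tree_size (rel_tree r) = n.
Proof. by move=> /free_relsP[sr fr ->]; rewrite size_gammabar // card_ord. Qed.

(** Transport the order of [gamma T] to ['I_n] along an enumeration, then use the invariance of
    [gammabar] under isomorphism. *)
Lemma rel_tree_onto n (T : fishburn) : tree_size T = n ->
  exists2 r, r \in free_rels n & rel_tree r = T.
Proof.
rewrite -card_gamma => eT; pose h (i : 'I_n) : gamma T := enum_val (cast_ord (esym eT) i).
have hb : bijective h.
  apply: bij_comp; first exact: enum_val_bij.
  exact: Bijective (cast_ordK _) (cast_ordKV _).
pose r := [set p : 'I_n * 'I_n | (h p.1 < h p.2)%O].
have rE i j : rel_of r i j = (h i < h j)%O by rewrite /rel_of inE.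
have sr : strict_order (rel_of r).
  apply/andP; split; first by apply/forallP => i; rewrite rE ltxx.
  apply/forallP => i; apply/forallP => j; apply/forallP => k; rewrite !rE.
  by apply/implyP => /andP[]; apply: lt_trans.
have [g hK gK] := hb; have rT := gamma_rep T.
have rr : representation (@Order.lt _ (ord_poset sr))
    (fun i => label T (ssval (h i))) (fun i => blab T (ssval (h i))) (maxlab T).
  split=> [i j|i|i|i /(rep_l_onto rT)[u eu]|i /(rep_b_onto rT)[u eu]].
  - by rewrite -(rep_lt rT) -rE.
  - exact: rep_l rT _.
  - exact: rep_b rT _.
  - by exists (g u); rewrite gK.
  - by exists (g u); rewrite gK.
have rF : r \in free_rels n by rewrite inE sr; apply: rep_free rr.
exists r => //; have [sr' fr ->] := free_relsP rF.
rewrite -[RHS]gammaK; apply: gammabar_iso; first exact: rep_free rT.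
by apply/rel_isoP; exists h => // x y; rewrite -rE.
Qed.

Definition class_tree n (c : {set {set 'I_n * 'I_n}}) : fishburn :=
  if [pick r in c] is Some r then rel_tree r else empty_fishburn.

(** By [rel_tree_eq] a class is a full fibre of [rel_tree], so [class_tree] does not depend on the
    element picked and determines the class. *)
Lemma mem_poset_classes n c : c \in poset_classes n ->
  exists2 r, r \in free_rels n
    & c = [set s in free_rels n | rel_tree s == class_tree c] /\ class_tree c = rel_tree r.
Proof.
move=> /imsetP[r rF ec].
have memc s : (s \in c) = (s \in free_rels n) && (rel_tree r == rel_tree s).
  by rewrite ec inE; case: (boolP (s \in free_rels n)) => //= sF; rewrite -rel_tree_eq.
have ct : class_tree c = rel_tree r.
  rewrite /class_tree; case: pickP => [s|/(_ r)]; last by rewrite memc eqxx rF.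
  by rewrite memc => /andP[_ /eqP].
by exists r => //; split=> //; apply/setP => s; rewrite inE memc ct eq_sym.
Qed.

Theorem corollary6p1 :
  (forall T : fishburn,
     [/\ poset_free (gamma T), #|{: gamma T}| = tree_size T & gammabar (gamma T) = T]) /\
  (forall (d : Order.disp_t) (Q : finPOrderType d), poset_free Q ->
     tree_size (gammabar Q) = #|Q| /\ poset_iso (gamma (gammabar Q)) Q) /\
  (forall (d d' : Order.disp_t) (Q : finPOrderType d) (Q' : finPOrderType d'),
     poset_free Q -> poset_free Q' -> poset_iso Q Q' ->
     gammabar Q = gammabar Q') /\
  (forall n : nat, 1 <= n ->
     (fishburn_trees n #= [set` poset_classes n]%classic)%card).
Proof.
split=> [T|].
  by split; [apply: rep_free (gamma_rep T) | apply: card_gamma | apply: gammaK].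
split=> [d Q fQ|]; first by split; [apply: size_gammabar | apply: gammabarK].
split=> [d d' Q Q' _|n _]; first exact: gammabar_iso.
(* Once [class_tree] is onto the trees of size [n], only its injectivity on classes remains. *)
have -> : fishburn_trees n = (@class_tree n @` [set` poset_classes n])%classic.
  apply/seteqP; split=> T /=.
    move=> /rel_tree_onto[r rF <-].
    pose c := [set s in free_rels n | rel_iso (rel_of r) (rel_of s)].
    have cP : c \in poset_classes n by apply: imset_f.
    exists c => //; have [_ _ [ec _]] := mem_poset_classes cP.
    have : r \in c by rewrite inE rF rel_tree_eq ?eqxx.
    by rewrite {1}ec inE => /andP[_ /eqP].
  by move=> [c /mem_poset_classes[r rF [_ ->]] <-]; apply: size_rel_tree.
apply: inj_card_eq => c c' /set_mem/mem_poset_classes[_ _ [ec _]].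
by move=> /set_mem/mem_poset_classes[_ _ [ec' _]] e; rewrite ec ec' e.
Qed.
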